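(* Let $Q$ be a type A quiver with $n$ vertices, $V\in rep_Q(\mathbf d)$ with rank parameter $\mathbf r$, and write $V\cong\bigoplus_{1\le p\le q\le n} m_{pq}I_{pq}$ with $I_{pq}$ the indecomposable representations of $Q$. Let $w=w_Q(\mathbf r)$ be the Zelevinsky permutation corresponding to $V$, regarded as an $(S'_Q,S_Q)$-blocked permutation matrix (a block partitioning whose block rows and columns are labelled by the vertices, the orders of the labels depending only on $Q$). Then for all $x,y\in Q_0$ the number of non-zero entries of $w$ in the block at the block row labelled $x$ and block column labelled $y$ is $$\begin{cases} m_{yx}, & y\le x,\\ n_{xy}, & y=x+1,\\ 0,&\text{otherwise,}\end{cases}\qquad\text{where } n_{xy}=\sum_{p\le x<y\le q}m_{pq}.$$
   Context: Quivers and representations. Let $k$ be an algebraically closed field. A type A quiver $Q$ has vertex set $Q_0=\{1,\dots,n\}$ and exactly one arrow between $x$ and $x+1$ for each $1\le x<n$ (and no others); an arrow $x\to x+1$ is a right arrow, an arrow $x+1\to x$ a left arrow. Left arrows are denoted $\alpha_1,\alpha_2,\dots$ and right arrows $\beta_1,\beta_2,\dots$, indices increasing from left to right. Fix a dimension vector $\mathbf d=(d_x)$ with all $d_x\ge 1$. $rep_Q(\mathbf d)$ is the set of tuples $V=(V_\gamma)_\gamma$ of matrices over $k$, $V_\gamma$ of size $d_{t(\gamma)}\times d_{s(\gamma)}$ for each arrow $\gamma:s(\gamma)\to t(\gamma)$; write $A_i=V_{\alpha_i}$, $B_i=V_{\beta_i}$. $\mathrm{GL}(\mathbf d)=\prod_x\mathrm{GL}(d_x)$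 acts by $g.V=(g_{t(\gamma)}V_\gamma g_{s(\gamma)}^{-1})_\gamma$; $\mathcal O_V$ is the orbit of $V$. For $1\le p\le q\le n$, $I_{pq}$ is the indecomposable representation with $k$ at the vertices $p,\dots,q$, zero at other vertices, and identity maps on arrows between vertices in $\{p,\dots,q\}$. Rank parameters. For an interval $[a,b]$ ($1\le a<b\le n$), $Q_{[a,b]}$ is the full subquiver on $a,\dots,b$. $M^Q_{[a,b]}(V)$ is the block matrix with block rows indexed by the sinks and block columns by the sources of $Q_{[a,b]}$ (both in decreasing order of integers), whose block at $(x,y)$ is the composition of the matrices of $V$ along the directed path from $y$ to $x$ if there is one, and $0$ otherwise. The rank parameter of $V$ is $\mathbf r=(r_{[a,b]})$, $r_{[a,b]}=\mathrm{rank}\,M^Q_{[a,b]}(V)$; it determines the orbit, and one writes $\mathcal O_{\mathbf r}=\mathcal O_V$. Sequences and blocked matrices. A sequence is a totally ordered set of vertices, order written $\prec$; $S\triangleleft S'$ is concatenation ($S$ first). A directed path is viewed as a sequence with $s(\gamma)\prec t(\gamma)$ for each of its arrows. Let $L_1,\dots,L_l$ be the maximal directed paths made of left arrows and $R_1,\dots,R_r$ those made of right arrows, numbered from left to right; $s(P),t(P)$ are start and end vertices of a path. Put $$S'_Q=R_1\setminus t(R_1)\triangleleft\cdots\triangleleft R_r\setminus t(R_r)\triangleleft\{n\}\triangleleft L_l\setminus s(L_l)\triangleleft\cdots\triangleleft L_1\setminus s(L_1),$$ $$S_Q=L_l\setminus t(L_l)\triangleleft\cdots\triangleleft L_1\setminus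 t(L_1)\triangleleft\{1\}\triangleleft R_1\setminus s(R_1)\triangleleft\cdots\triangleleft R_r\setminus s(R_r).$$ An $(S'_Q,S_Q)$-blocked matrix is an $N\times N$ matrix, $N=\sum_xd_x$, with block rows labelled top to bottom by $S'_Q$ and block columns labelled left to right by $S_Q$ (ascending order), block row/column $[x]$ having height/width $d_x$. The $([x],[y])$-block is in block row $[x]$, block column $[y]$. $A_{[x]\times[y]}$ is the southwest submatrix formed by block rows with label $\succeq x$ in $S'_Q$ and block columns with label $\preceq y$ in $S_Q$. A permutation $w\in S_N$ is identified with the matrix with $1$ at $(w(j),j)$ and $0$ elsewhere. Zelevinsky map. $\zeta_Q(V)$ is the $(S'_Q,S_Q)$-blocked matrix with $([x],[y])$-block: $I_{d_x}$ if $x=y$; $0$ if there is no directed path from $y$ to $x$; $A_i$ if $y=x+1$ and $\alpha_i:x+1\to x$; $0$ if $y>x+1$ and there is a directed path from $y$ to $x$; $B_j\cdots B_{i+1}B_i$ if $y<x$ and there is a directed path from $y$ to $x$ with arrows $\beta_i,\beta_{i+1},\dots,\beta_j$. Zelevinsky permutation. An $(S'_Q,S_Q)$-blocked permutation matrix is of Z-type if the nonzero entries in each block form an identity matrix (possibly smaller than the block), and within each block row these identity matrices are arranged from southwest to northeast, and within each block column from northwest to southeast. $w_Q(\mathbf r)$ is the unique $(S'_Q,S_Q)$-blocked permutation of Z-type with $\mathrm{rank}\,w_Q(\mathbf r)_{[x]\times[y]}=\mathrm{rank}\,\zeta_Q(V)_{[x]\times[y]}$ for all $V\in\mathcal O_{\mathbf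 r}$, $x,y\in Q_0$. *)

(* Defs.v *)
From mathcomp Require Import all_boot all_order all_fingroup all_algebra.
Set Implicit Arguments.
Unset Strict Implicit.
Unset Printing Implicit Defensive.
Import GRing.Theory.
Local Open Scope ring_scope.

(* A type A quiver with n.+1 vertices and n arrows.  Vertices are numbered
   from 0: vertex x of {1, .., n.+1} is the element of value x - 1 of 'I_n.+1.
   The arrow a : 'I_n joins the vertices a and a + 1; Q a = true means that it
   is the right arrow a -> a + 1, and Q a = false that it is the left arrow
   a + 1 -> a. *)
Definition quiverA (n : nat) := 'I_n -> bool.

Section Quiver.
Variables (n : nat) (Q : quiverA n).
Implicit Types (a b x y : 'I_n.+1).

Definition lower (e : 'I_n) : 'I_n.+1 := widen_ord (leqnSn n) e.
Definition upper (e : 'I_n) : 'I_n.+1 := lift ord0 e.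
Definition src (e : 'I_n) := if Q e then lower e else upper e.
Definition tgt (e : 'I_n) := if Q e then upper e else lower e.
Definition arrow x y := [exists e, (src e == x) && (tgt e == y)].

Definition interval a b : seq 'I_n.+1 :=
  [seq x : 'I_n.+1 <- enum 'I_n.+1 | (a <= x <= b)%N].

(* [a, b] supports a maximal directed path made of right arrows (c = true) or
   of left arrows (c = false). *)
Definition maximal_run (c : bool) a b :=
  [&& (a < b)%N,
      [forall e : 'I_n, (a <= e < b)%N ==> (Q e == c)] &
      [forall e : 'I_n, ((e.+1 == a :> nat) || (e == b :> nat)) ==> (Q e != c)]].

Definition runs (c : bool) : seq ('I_n.+1 * 'I_n.+1) :=
  [seq ab <- [seq (a, b) | a <- enum 'I_n.+1, b <- enum 'I_n.+1]
     | maximal_run c ab.1 ab.2].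

(* R_1, .., R_r and L_1, .., L_l; each path is listed from its start vertex to
   its end vertex. *)
Definition right_paths : seq (seq 'I_n.+1) :=
  [seq interval ab.1 ab.2 | ab <- runs true].
Definition left_paths : seq (seq 'I_n.+1) :=
  [seq rev (interval ab.1 ab.2) | ab <- runs false].

(* P \ s(P) and P \ t(P) *)
Definition drop_start (P : seq 'I_n.+1) := behead P.
Definition drop_end (P : seq 'I_n.+1) := take (size P).-1 P.

(* S'_Q *)
Definition row_labels : seq 'I_n.+1 :=
  flatten [seq drop_end P | P <- right_paths]
    ++ [:: ord_max]
    ++ flatten [seq drop_start P | P <- rev left_paths].

(* S_Q *)
Definition col_labels : seq 'I_n.+1 :=
  flatten [seq drop_end P | P <- rev left_paths]
    ++ [:: ord0]
    ++ flatten [seq drop_start P | P <- right_paths].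

(* The order of a sequence of vertices. *)
Definition preceq (s : seq 'I_n.+1) x y := (index x s <= index y s)%N.
Definition prec (s : seq 'I_n.+1) x y := (index x s < index y s)%N.

(* The vertices through which a directed path from y to x has to go, other
   than y itself, in the order in which they are met. *)
Definition steps y x : seq 'I_n.+1 :=
  if (y <= x)%N then behead (interval y x) else behead (rev (interval x y)).

Definition has_path y x := path arrow y (steps y x).

Definition in_sub a b (e : 'I_n) :=
  (a <= src e <= b)%N && (a <= tgt e <= b)%N.

Definition sinks a b : seq 'I_n.+1 :=
  rev [seq x <- interval a b | [forall e, in_sub a b e ==> (src e != x)]].
Definition sources a b : seq 'I_n.+1 :=
  rev [seq x <- interval a b | [forall e, in_sub a b e ==> (tgt e != x)]].

End Quiver.

Section Blocked.
Variables (k : fieldType) (n : nat) (d : 'I_n.+1 -> nat).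
Implicit Types (s : seq 'I_n.+1) (x y : 'I_n.+1).

Definition totdim : nat := (\sum_x d x)%N.

Definition bdim s : nat := (\sum_(i < size s) d (tnth (in_tuple s) i))%N.

Definition label s (i : 'I_(bdim s)) : 'I_n.+1 :=
  tnth (in_tuple s) (tagnat.sig1 i).

Definition blocked_mx (rs cs : seq 'I_n.+1)
    (F : forall x y, 'M[k]_(d x, d y)) : 'M[k]_(bdim rs, bdim cs) :=
  \mxblock_(i < size rs, j < size cs)
    F (tnth (in_tuple rs) i) (tnth (in_tuple cs) j).

Definition submx_of (p q : nat) (I : {set 'I_p}) (J : {set 'I_q})
    (A : 'M[k]_(p, q)) : 'M[k]_(#|I|, #|J|) :=
  mxsub (@enum_val _ (mem I)) (@enum_val _ (mem J)) A.

(* A_{[x] x [y]} *)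
Definition southwest rs cs (A : 'M[k]_(bdim rs, bdim cs)) x y :=
  submx_of [set i | preceq rs x (label i)] [set j | preceq cs (label j) y] A.

Definition block_support rs cs (A : 'M[k]_(bdim rs, bdim cs)) x y :=
  [set ij : 'I_(bdim rs) * 'I_(bdim cs) |
    [&& label ij.1 == x, label ij.2 == y & A ij.1 ij.2 != 0]].

(* In each block the nonzero entries are exactly the diagonal entries of a
   square window of consecutive rows and columns.  Southwest to northeast
   within a block row: passing to a block further to the right, the nonzero
   entries move up.  Northwest to southeast within a block column: passing to
   a block further down, they move to the right. *)
Definition Ztype rs cs (A : 'M[k]_(bdim rs, bdim cs)) : Prop :=
  [/\ forall x y, exists i0 j0 t : nat,
        forall i j, label i = x -> label j = y ->
          (A i j != 0 <->
             exists2 u, (u < t)%N & (i = (i0 + u)%N :> nat /\ j = (j0 + u)%N :> nat))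
             /\ (A i j != 0 -> A i j = 1),
      forall i i' j j', label i = label i' -> prec cs (label j) (label j') ->
        A i j != 0 -> A i' j' != 0 -> (i' < i)%N
    & forall i i' j j', label j = label j' -> prec rs (label i) (label i') ->
        A i j != 0 -> A i' j' != 0 -> (j < j')%N].

End Blocked.

Section Labels.
Variables (n : nat) (Q : quiverA n).
Implicit Types (a b x : 'I_n.+1) (c : bool).

Lemma mem_interval a b x : (x \in interval a b) = (a <= x <= b)%N.
Proof. by rewrite mem_filter mem_enum andbT. Qed.

Lemma map_val_interval a b : (a <= b)%N ->
  map val (interval a b) = iota a (b - a).+1.
Proof.
move=> ab; apply: (@irr_sorted_eq _ ltn ltn_trans ltnn).
- apply: (subseq_sorted ltn_trans (map_subseq val (filter_subseq _ _))).
  by rewrite val_enum_ord iota_ltn_sorted.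
- exact: iota_ltn_sorted.
move=> z; rewrite mem_iota addnS subnKC // ltnS.
apply/mapP/idP => [[x]|]; first by rewrite mem_interval => ? ->.
move=> /andP[az zb].
have zn : (z < n.+1)%N by apply: leq_ltn_trans zb (ltn_ord b).
by exists (Ordinal zn) => //; rewrite mem_interval /= az.
Qed.

Lemma size_interval a b : (a <= b)%N -> size (interval a b) = (b - a).+1.
Proof. by move=> /map_val_interval/(congr1 size); rewrite size_map size_iota. Qed.

Lemma uniq_interval a b : uniq (interval a b).
Proof. exact/filter_uniq/enum_uniq. Qed.

Lemma mem_drop_start a b x : (a < b)%N ->
  (x \in drop_start (interval a b)) = (a < x <= b)%N.
Proof.
move=> ab; have ab' := ltnW ab.
rewrite -(mem_map val_inj) /drop_start -behead_map map_val_interval //=.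
by rewrite mem_iota addSn subnKC // ltnS.
Qed.

Lemma mem_drop_end a b x : (a < b)%N ->
  (x \in drop_end (interval a b)) = (a <= x < b)%N.
Proof.
move=> ab; have ab' := ltnW ab.
rewrite -(mem_map val_inj) /drop_end map_take map_val_interval //.
rewrite size_interval // take_iota (minn_idPl _) //=.
by rewrite mem_iota subnKC.
Qed.

Lemma drop_start_rev (s : seq 'I_n.+1) :
  drop_start (rev s) = rev (drop_end s).
Proof. by rewrite /drop_start /drop_end -drop1 drop_rev subn1. Qed.

Lemma drop_end_rev (s : seq 'I_n.+1) :
  drop_end (rev s) = rev (drop_start s).
Proof.
rewrite /drop_start /drop_end size_rev take_rev -drop1.
case: s => [|y s] //=; by rewrite subSnn.
Qed.

Lemma uniq_drop_start a b : uniq (drop_start (interval a b)).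
Proof. by rewrite /drop_start -drop1; apply/drop_uniq/uniq_interval. Qed.

Lemma uniq_drop_end a b : uniq (drop_end (interval a b)).
Proof. exact/take_uniq/uniq_interval. Qed.

Lemma mem_runs c ab : (ab \in runs Q c) = maximal_run Q c ab.1 ab.2.
Proof.
rewrite mem_filter andbC; case: ab => a b /=.
by rewrite allpairs_f ?mem_enum.
Qed.

Lemma uniq_runs c : uniq (runs Q c).
Proof.
by apply: filter_uniq; apply: allpairs_uniq; rewrite ?enum_uniq // => -[? ?] [? ?].
Qed.

Lemma ex_run (e : 'I_n) : exists ab : 'I_n.+1 * 'I_n.+1,
  maximal_run Q (Q e) ab.1 ab.2 && (ab.1 <= e < ab.2)%N.
Proof.
pose PA i := (i <= e)%N && [forall e' : 'I_n, (i <= e' <= e)%N ==> (Q e' == Q e)].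
have exA : exists i, PA i.
  exists e; rewrite /PA leqnn; apply/forallP=> e'; apply/implyP => h.
  by rewrite (_ : e' = e) //; apply/val_inj/eqP; rewrite eqn_leq andbC.
pose PB i := (e < i <= n)%N && [forall e' : 'I_n, (e <= e' < i)%N ==> (Q e' == Q e)].
have exB : exists i, PB i.
  exists e.+1; rewrite /PB leqnn ltn_ord; apply/forallP=> e'; apply/implyP.
  by rewrite ltnS => h; rewrite (_ : e' = e) //; apply/val_inj/eqP; rewrite eqn_leq andbC.
have ubB i : PB i -> (i <= n)%N by case/andP=> /andP[].
case: (ex_minnP exA) => a /andP[ae /forallP hA] minA.
case: (ex_maxnP exB ubB) => b /andP[/andP[eb bn] /forallP hB] maxB.
have an : (a < n.+1)%N by rewrite ltnS (leq_trans ae) // ltnW.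
exists (Ordinal an, Ordinal (bn : (b < n.+1)%N)) => /=; rewrite ae eb !andbT.
rewrite /maximal_run; apply/and3P; split=> /=; first exact: leq_ltn_trans eb.
  apply/forallP=> e'; apply/implyP=> /andP[ae' eb'].
  case: (leqP e' e) => le; first by have := hA e'; rewrite ae' le.
  by have := hB e'; rewrite eb' (ltnW le).
apply/forallP=> e'; apply/implyP=> /orP[] /eqP he; apply/negP=> ce.
  have : PA e'.
    rewrite /PA (leq_trans _ ae) -?he //; apply/forallP=> f; apply/implyP=> /andP[].
    rewrite leq_eqVlt => /orP[/eqP/val_inj <- // | lt fe].
    by have := hA f; rewrite fe -he lt.
  by move/minA; rewrite -he ltnn.
have : PB b.+1.
  rewrite /PB [(e < b.+1)%N]ltnS (ltnW eb) /= -{1}he ltn_ord; apply/forallP=> f; apply/implyP=> /andP[ef].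
  rewrite ltnS leq_eqVlt -{1}he => /orP[/eqP/val_inj -> // | lt].
  by have := hB f; rewrite ef lt.
by move/maxB; rewrite ltnn.
Qed.

Lemma run_inj c (e : 'I_n) a b a' b' :
  maximal_run Q c a b -> maximal_run Q c a' b' ->
  (a <= e < b)%N -> (a' <= e < b')%N -> (a <= a')%N && (b' <= b)%N.
Proof.
move=> /and3P[_ _ /forallP hm] /and3P[_ /forallP hr _].
move=> /andP[ae eb] /andP[ae' eb']; apply/andP; split; rewrite leqNgt; apply/negP=> lt.
  have a_gt0 : (0 < a)%N by apply: leq_ltn_trans lt.
  have a0 : (a.-1 < n)%N by rewrite prednK // -ltnS ltn_ord.
  have := hm (Ordinal a0); have := hr (Ordinal a0); rewrite /= prednK // eqxx /=.
  have -> : (a' <= a.-1)%N by rewrite -ltnS prednK.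
  by rewrite (leq_trans ae (ltnW eb')) /= => ->.
have b0 : (b < n)%N by rewrite -ltnS (leq_trans _ (ltn_ord b')).
have := hm (Ordinal b0); have := hr (Ordinal b0); rewrite /= eqxx orbT /=.
by rewrite lt (leq_trans ae') 1?ltnW //= => ->.
Qed.

Lemma count_runs c (e : 'I_n) :
  count (fun ab : 'I_n.+1 * 'I_n.+1 => (ab.1 <= e < ab.2)%N) (runs Q c)
    = (Q e == c).
Proof.
have [<-|neq] := eqVneq (Q e) c; last first.
  apply/eqP; rewrite /= -leqn0 leqNgt -has_count; apply/hasPn=> ab.
  rewrite mem_runs => /and3P[_ /forallP/(_ e) h _].
  by apply: contra neq => h'; rewrite h' in h.
have [[a b] /= /andP[hm he]] := ex_run e.
rewrite (@eq_in_count _ _ (pred1 (a, b))); last first.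
  move=> [a' b']; rewrite mem_runs /= => hm'; apply/idP/eqP => [he'|[-> ->]//].
  have /andP[h1 h2] := run_inj hm hm' he he'.
  have /andP[h3 h4] := run_inj hm' hm he' he.
  by congr pair; apply/val_inj/eqP; rewrite eqn_leq ?h1 ?h2 ?h3 ?h4.
by rewrite count_uniq_mem ?uniq_runs // mem_runs hm.
Qed.

Lemma count_flatten_runs c (f : 'I_n.+1 * 'I_n.+1 -> seq 'I_n.+1) x
    (p : pred ('I_n.+1 * 'I_n.+1)) :
  (forall ab : 'I_n.+1 * 'I_n.+1,
     (ab.1 < ab.2)%N -> uniq (f ab) /\ (x \in f ab) = p ab) ->
  count_mem x (flatten [seq f ab | ab <- runs Q c]) = count p (runs Q c).
Proof.
move=> hf; rewrite count_flatten -map_comp -sumn_count; congr sumn.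
apply/eq_in_map => ab; rewrite mem_runs => /and3P[/hf[uf <-] _ _] /=.
exact: count_uniq_mem.
Qed.

Lemma count_flatten_rev (s : seq (seq 'I_n.+1)) x :
  count_mem x (flatten (rev s)) = count_mem x (flatten s).
Proof. by apply/seq.permP/perm_flatten; rewrite perm_rev. Qed.

Lemma perm_row_labels : perm_eq (row_labels Q) (enum 'I_n.+1).
Proof.
apply/allP => x _ /=; apply/eqP.
rewrite [RHS]count_uniq_mem ?enum_uniq // mem_enum !count_cat.
rewrite map_rev count_flatten_rev -map_comp.
pose p := fun ab : 'I_n.+1 * 'I_n.+1 => (ab.1 <= x < ab.2)%N.
rewrite -map_comp !(@count_flatten_runs _ _ x p) /=; try by move=> ab h; rewrite /= ?drop_start_rev ?rev_uniq uniq_drop_end ?mem_rev ?mem_drop_end.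
have [xn|xn] := ltnP x n.
  have cr c : count p (runs Q c) = (Q (Ordinal xn) == c) by rewrite -count_runs.
  rewrite !cr -val_eqE /= gtn_eqF //.
  by case: (Q _).
have -> : x = ord_max by apply/val_inj/eqP; rewrite /= eqn_leq xn andbT; exact: (ltn_ord x).
rewrite eqxx; have cr c : count p (runs Q c) = 0%N.
  apply/eqP; rewrite -leqn0 leqNgt -has_count; apply/hasPn=> ab _.
  apply/negP => /andP[_ xb].
  by have := leq_ltn_trans xn (leq_trans xb (ltn_ord ab.2 : (ab.2 <= n)%N)); rewrite ltnn.
by rewrite !cr.
Qed.

Lemma perm_col_labels : perm_eq (col_labels Q) (enum 'I_n.+1).
Proof.
apply/allP => x _ /=; apply/eqP.
rewrite [RHS]count_uniq_mem ?enum_uniq // mem_enum !count_cat.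
rewrite map_rev count_flatten_rev -map_comp.
pose p := fun ab : 'I_n.+1 * 'I_n.+1 => (ab.1 < x <= ab.2)%N.
rewrite -map_comp !(@count_flatten_runs _ _ x p) /=; try by move=> ab h; rewrite /= ?drop_end_rev ?rev_uniq uniq_drop_start ?mem_rev ?mem_drop_start.
have [x0|x0] := posnP x.
  have -> : x = ord0 by exact/val_inj.
  rewrite eqxx; have cr c : count p (runs Q c) = 0%N.
    apply/eqP; rewrite -leqn0 leqNgt -has_count; apply/hasPn=> ab _.
    by rewrite /p x0 ltn0.
  by rewrite !cr.
have xn : (x.-1 < n)%N by rewrite prednK // -ltnS.
have cr c : count p (runs Q c) = (Q (Ordinal xn) == c).
  by rewrite -count_runs; apply: eq_count => ab; rewrite /p /= -{1}(prednK x0) ltnS prednK.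
rewrite !cr -val_eqE /= ltn_eqF //.
by case: (Q _).
Qed.

Lemma bdim_perm (d : 'I_n.+1 -> nat) s :
  perm_eq s (enum 'I_n.+1) -> bdim d s = totdim d.
Proof.
move=> h; transitivity (\sum_(x <- s) d x)%N; first by rewrite big_tnth.
by rewrite (perm_big _ h) big_enum.
Qed.

Lemma bdim_row (d : 'I_n.+1 -> nat) : bdim d (row_labels Q) = totdim d.
Proof. exact/bdim_perm/perm_row_labels. Qed.

Lemma bdim_col (d : 'I_n.+1 -> nat) : bdim d (col_labels Q) = totdim d.
Proof. exact/bdim_perm/perm_col_labels. Qed.

End Labels.

Section Representations.
Variables (k : fieldType) (n : nat) (Q : quiverA n).
Implicit Types (d : 'I_n.+1 -> nat) (a b x y p q : 'I_n.+1).

Definition rep d : Type := forall e : 'I_n, 'M[k]_(d (tgt Q e), d (src Q e)).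

Definition rep_iso d d' (V : rep d) (W : rep d') : Prop :=
  exists (g : forall x, 'M[k]_(d' x, d x)) (h : forall x, 'M[k]_(d x, d' x)),
    (forall x, h x *m g x = 1%:M /\ g x *m h x = 1%:M) /\
    (forall e, g (tgt Q e) *m V e = W e *m g (src Q e)).

(* V' belongs to the GL(d)-orbit of V. *)
Definition in_orbit d (V V' : rep d) : Prop :=
  exists g : forall x, 'M[k]_(d x),
    (forall x, g x \in unitmx) /\
    (forall e, V' e = g (tgt Q e) *m V e *m invmx (g (src Q e))).

(* I_pq.  The matrices are 1 x 1 when both ends of the arrow lie in [p, q],
   and otherwise have no entries. *)
Definition indec_dim p q x : nat := (p <= x <= q)%N.
Definition indec p q : rep (indec_dim p q) := fun=> const_mx 1.

Definition zero_rep : rep (fun=> 0%N) := fun=> 0.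

Definition dsum_rep d d' (V : rep d) (W : rep d') :
    rep (fun x => (d x + d' x)%N) :=
  fun e => block_mx (V e) 0 0 (W e).

Fixpoint indecs_dim (s : seq ('I_n.+1 * 'I_n.+1)) : 'I_n.+1 -> nat :=
  if s is pq :: s' then fun x => (indec_dim pq.1 pq.2 x + indecs_dim s' x)%N
  else fun=> 0%N.

Fixpoint indecs_sum (s : seq ('I_n.+1 * 'I_n.+1)) : rep (indecs_dim s) :=
  if s is pq :: s' return rep (indecs_dim s)
  then dsum_rep (indec pq.1 pq.2) (indecs_sum s') else zero_rep.

(* The list containing each pair (p, q) with p <= q exactly m p q times. *)
Definition with_mult (m : 'I_n.+1 -> 'I_n.+1 -> nat) :
    seq ('I_n.+1 * 'I_n.+1) :=
  flatten [seq nseq (if (p <= q)%N then m p q else 0) (p, q)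
            | p <- enum 'I_n.+1, q <- enum 'I_n.+1].

Section Matrices.
Variables (d : 'I_n.+1 -> nat) (V : rep d).

(* The matrix of the arrow y -> x, or 0 if there is none: the sum has at most
   one term, whose size is that of the target type, so that conform_mx is then
   the identity. *)
Definition arrow_mx x y : 'M[k]_(d x, d y) :=
  \sum_(e | (src Q e == y) && (tgt Q e == x)) conform_mx 0 (V e).

(* The composition of the matrices along the path which starts at y and then
   goes through the vertices of s, the last one being x. *)
Fixpoint comp_mx x y (s : seq 'I_n.+1) : 'M[k]_(d x, d y) :=
  if s is z :: s' then comp_mx x z s' *m arrow_mx z y
  else if x == y then conform_mx 0 (1%:M : 'M[k]_(d x)) else 0.

Definition path_mx x y : 'M[k]_(d x, d y) := comp_mx x y (steps y x).

(* M^Q_[a,b](V) *)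
Definition interval_mx a b :=
  blocked_mx (sinks Q a b) (sources Q a b)
    (fun x y => if has_path Q y x then path_mx x y else 0).

Definition has_rank_parameter (r : 'I_n.+1 -> 'I_n.+1 -> nat) : Prop :=
  forall a b, (a < b)%N -> r a b = \rank (interval_mx a b).

Definition zelevinsky_block x y : 'M[k]_(d x, d y) :=
  if x == y then conform_mx 0 (1%:M : 'M[k]_(d x))
  else if ~~ has_path Q y x then 0
  else if y == x.+1 :> nat then arrow_mx x y
  else if (x.+1 < y)%N then 0
  else path_mx x y.

Definition zelevinsky_mx : 'M[k]_(bdim d (row_labels Q), bdim d (col_labels Q)) :=
  blocked_mx (row_labels Q) (col_labels Q) zelevinsky_block.

End Matrices.

(* V belongs to O_r. *)
Definition in_rank_orbit d (r : 'I_n.+1 -> 'I_n.+1 -> nat) (V : rep d) : Prop :=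
  exists V0 : rep d, has_rank_parameter V0 r /\ in_orbit V0 V.

(* The (S'_Q, S_Q)-blocked matrix of w.  Its entry 1 in column j is in row
   w j; MathComp's perm_mx w has it in column w i of row i instead. *)
Definition blocked_perm_mx d (w : 'S_(totdim d)) :
    'M[k]_(bdim d (row_labels Q), bdim d (col_labels Q)) :=
  \matrix_(i, j)
    (cast_ord (bdim_row Q d) i == w (cast_ord (bdim_col Q d) j))%:R.

(* The characterization of w_Q(r). *)
Definition is_zelevinsky_perm d (r : 'I_n.+1 -> 'I_n.+1 -> nat)
    (w : 'S_(totdim d)) : Prop :=
  Ztype (blocked_perm_mx w) /\
  forall V : rep d, in_rank_orbit r V -> forall x y,
    \rank (southwest (blocked_perm_mx w) x y)
      = \rank (southwest (zelevinsky_mx V) x y).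

End Representations.

(* Main.v *)
Require Import Defs.
From mathcomp Require Import all_boot all_order all_fingroup all_algebra.
From mathcomp Require Import zify ring.
Set Implicit Arguments.
Unset Strict Implicit.
Unset Printing Implicit Defensive.
Import GRing.Theory.

(** The nonzero entries of a permutation matrix that lie in the block rows from
    [x] on and in the block columns up to [y] are as many as the rank of this
    southwest submatrix.  So the southwest ranks of [w] are the
    southwest partial sums of the numbers of nonzero entries of its blocks, and
    these partial sums determine the numbers ([eq_of_southwest_sums]).  It
    remains to see that the southwest ranks of the Zelevinsky matrix of [V] are
    the partial sums of the numbers claimed.

    Both sides are additive in [V].  The blocks of the Zelevinsky matrix are
    natural in the representation ([zelevinsky_block_natural]), so its southwest
    ranks do not change under isomorphism and add up over direct sums; and the
    claimed numbers are linear in the multiplicities.  Hence [V] may be taken to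
    be an indecomposable [I_pq].

    The Zelevinsky matrix of [I_pq] is a 0/1 matrix [Z] with rows and columns
    [p, .., q]; its entry at (x, y) is 1 when x = y, when right arrows lead from
    y to x, or when y = x + 1 and the arrow between them is a left one.  The
    claimed numbers form the matrix [C] of a cyclic permutation: column [p] has
    its 1 in row [q], and every other column [y] has it in row [y - 1].  The
    point is a Bruhat factorization [Z = L C U] ([factorization]) in which [L] is
    invertible and upper triangular for the order of the row labels, and [U] for
    that of the column labels.  Such factors restrict to every final segment of
    the rows and every initial segment of the columns, whence [Z] and [C] have
    the same southwest ranks ([mxrank_rect_mask_triangular]).

    For the factors, change the sign of the basis vectors so that left arrows
    act by -1.  Let e_x be the basis vectors and let T_y be the sum of the e_x
    for x reached from y by right arrows.  Column y of [Z] is then T_y, or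
    T_y - e_(y-1) = T_y - T_(y-1) if p < y and a left arrow leaves y.  Set
    m_y = T_y - T_(y-1) for p < y <= q, which is - e_(y-1) if the arrow between
    y - 1 and y is a right one, and let m_p be the sum of e_q and of the e_x
    with x < q from which a right arrow leaves.  Up to the order of the columns
    these are the columns of [L], and in the remaining case column y is
      T_y = m_p + (sum of the m_z for z <= y entered by a right arrow)
                - (sum of the m_z for z > y left by a left arrow),
    with p < z <= q; all z occurring come at or before y in the order of the
    column labels. *)

(** * The order of the block labels *)

Lemma pairwise_flatten (T : Type) (r : rel T) (ss : seq (seq T)) :
  pairwise r (flatten ss) = all (pairwise r) ss && pairwise (allrel r) ss.
Proof.
elim: ss => //= s ss IH; rewrite pairwise_cat IH andbCA -!andbA.
suff -> : allrel r s (flatten ss) = all (allrel r s) ss by do !bool_congr.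
by elim: ss {IH} => /= [|s' ss IH]; rewrite ?allrel0r // allrel_catr IH.
Qed.

Lemma pairwise_rev (T : Type) (r : rel T) (s : seq T) :
  pairwise r (rev s) = pairwise (fun x y => r y x) s.
Proof.
by elim: s => //= x s IH; rewrite rev_cons pairwise_rcons all_rev IH.
Qed.

Lemma sub_pairwise_in (T : eqType) (r r' : rel T) (s : seq T) :
  {in s &, forall x y, r x y -> r' x y} -> pairwise r s -> pairwise r' s.
Proof. by move=> rr'; apply: (sub_in_pairwise rr'); apply/allP. Qed.

Section Order.
Variables (n : nat) (Q : quiverA n).
Implicit Types (a b x y : 'I_n.+1) (c : bool).

(** Two runs in the same direction share no arrow, so a run that starts earlier
    also ends before the other one starts. *)
Lemma pairwise_runs c :
  pairwise (fun ab cd : 'I_n.+1 * 'I_n.+1 => ab.2 <= cd.1)%N (runs Q c).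
Proof.
have lex : pairwise (fun ab cd : 'I_n.+1 * 'I_n.+1 => ab.1 <= cd.1)%N (runs Q c).
  apply: pairwise_filter; rewrite pairwise_flatten; apply/andP; split.
    apply/allP=> _ /mapP[a _ ->]; rewrite pairwise_map /=.
    by elim: (enum _) => //= b s ->; rewrite andbT; apply/allP => ? _ /=.
  rewrite pairwise_map; apply: (@sub_pairwise _ (relpre val ltn)) => [a a' /= lt_aa'|].
    by apply/allrelP=> _ _ /mapP[b _ ->] /mapP[b' _ ->] /=; exact: ltnW.
  by rewrite -pairwise_map val_enum_ord 
    -sorted_pairwise ?iota_ltn_sorted //; exact: ltn_trans.
have := uniq_runs Q c; rewrite uniq_pairwise => ne.
have := conj lex ne => /andP; rewrite -pairwise_relI.
(* Otherwise the arrow which starts at a' belongs to both runs. *)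
apply: sub_pairwise_in => -[a b] [a' b']; rewrite !mem_runs /=.
move=> run run' /andP[aa']; apply: contraR.
rewrite -ltnNge => a'b.
have a'n : (a' < n)%N by apply: leq_trans a'b _; rewrite -ltnS.
have a'b' : (a' < b')%N by case/and3P: run'.
have in1 : (a <= Ordinal a'n < b)%N by rewrite /= aa'.
have in2 : (a' <= Ordinal a'n < b')%N by rewrite /= leqnn.
have /andP[h1 h2] := run_inj run run' in1 in2.
have /andP[h3 h4] := run_inj run' run in2 in1.
by apply/eqP; congr pair; apply/val_inj/eqP; rewrite eqn_leq /= ?h1 ?h2 ?h3 ?h4.
Qed.

(** The direction of the arrows as a function on all natural numbers, so that
    arrows can be named by arithmetic on vertices.  There is no arrow beyond the
    last vertex, which [row_labels] puts after the start vertices of the right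
    arrows: the value [true] there makes [row_key] correct at this vertex too. *)
Definition is_right (e : nat) : bool := if insub e is Some e' then Q e' else true.

Lemma is_right_ord (e : 'I_n) : is_right e = Q e.
Proof. by rewrite /is_right valK. Qed.

Lemma is_right_out e : (n <= e)%N -> is_right e.
Proof. by move=> ne; rewrite /is_right insubF // ltnNge ne. Qed.

(** In [row_labels] the vertices whose upper arrow is a right one come first,
    upwards, then the last vertex, then the others, downwards.  In [col_labels]
    the vertices whose lower arrow is a left one come first, downwards, then the
    first vertex, then the others, upwards.  The two keys are numbers which
    increase along these orders. *)
Definition row_key (x : nat) : nat := if is_right x then x else (n + n - x)%N.
Definition col_key (y : nat) : nat :=
  if (y == 0)%N || is_right y.-1 then (n + y)%N else (n - y)%N.

Lemma row_key_inj : injective (fun x : 'I_n.+1 => row_key x).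
Proof.
move=> x x' /= eqk; apply/val_inj => /=; move: eqk; rewrite /row_key.
have := ltn_ord x; have := ltn_ord x'.
have := @is_right_out x; have := @is_right_out x'.
by case: (is_right x) (is_right x') => -[]; lia.
Qed.

Lemma col_key_inj : injective (fun x : 'I_n.+1 => col_key x).
Proof.
move=> x x' /= eqk; apply/val_inj => /=; move: eqk; rewrite /col_key.
have := ltn_ord x; have := ltn_ord x'.
by case: (is_right x.-1) (is_right x'.-1) => -[]; case: eqP; case: eqP => /=; lia.
Qed.

Definition run_heads c :=
  flatten [seq drop_end (Defs.interval ab.1 ab.2) | ab <- runs Q c].
Definition run_tails c :=
  flatten [seq drop_start (Defs.interval ab.1 ab.2) | ab <- runs Q c].

Lemma pairwise_interval a b : pairwise (fun x y => x < y)%N (Defs.interval a b).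
Proof.
apply: pairwise_filter; have := iota_ltn_sorted 0 n.+1.
by rewrite -val_enum_ord sorted_map sorted_pairwise //; move=> x y z; exact: ltn_trans.
Qed.

Lemma pairwise_flatten_runs c (f : 'I_n.+1 * 'I_n.+1 -> seq 'I_n.+1) :
  (forall ab, ab \in runs Q c -> pairwise (fun x y => x < y)%N (f ab)) ->
  (forall ab cd, ab \in runs Q c -> cd \in runs Q c -> (ab.2 <= cd.1)%N ->
    {in f ab & f cd, forall x y, x < y}%N) ->
  pairwise (fun x y => x < y)%N (flatten [seq f ab | ab <- runs Q c]).
Proof.
move=> hin hout; rewrite pairwise_flatten; apply/andP; split.
  by apply/allP=> _ /mapP[ab h ->]; exact: hin.
rewrite pairwise_map; apply: sub_pairwise_in (pairwise_runs c).
by move=> ab cd h h' /= le; apply/allrelP; exact: hout.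
Qed.

Lemma run_headsP c : pairwise (fun x y => x < y)%N (run_heads c) /\
  forall x, x \in run_heads c -> (x < n)%N /\ is_right x = c.
Proof.
split.
  apply: pairwise_flatten_runs => [ab _|ab cd].
    by apply: (subseq_pairwise _ (pairwise_interval ab.1 ab.2)); exact: take_subseq.
  rewrite !mem_runs => /and3P[lt _ _] /and3P[lt' _ _] le x y.
  rewrite !mem_drop_end // => /andP[_ xb] /andP[cy _].
  exact: leq_trans (leq_trans xb le) cy.
move=> x /flattenP[_ /mapP[ab + ->]]; rewrite mem_runs => /and3P[lt /forallP all _].
rewrite mem_drop_end // => xab.
have xn : (x < n)%N.
  by case/andP: xab => _ /leq_trans; apply; rewrite -ltnS.
split=> //; have /implyP/(_ xab)/eqP <- := all (Ordinal xn).
by rewrite -is_right_ord.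
Qed.

Lemma run_tailsP c : pairwise (fun x y => x < y)%N (run_tails c) /\
  forall x, x \in run_tails c -> (0 < x)%N /\ is_right x.-1 = c.
Proof.
split.
  apply: pairwise_flatten_runs => [ab _|ab cd].
    apply: (subseq_pairwise _ (pairwise_interval ab.1 ab.2)).
    by rewrite /drop_start -drop1; exact: drop_subseq.
  rewrite !mem_runs => /and3P[lt _ _] /and3P[lt' _ _] le x y.
  rewrite !mem_drop_start // => /andP[_ xb] /andP[cy _].
  exact: leq_ltn_trans (leq_trans xb le) cy.
move=> x /flattenP[_ /mapP[ab + ->]]; rewrite mem_runs => /and3P[lt /forallP all _].
rewrite mem_drop_start // => xab.
have x_gt0 : (0 < x)%N by case/andP: xab => /(leq_ltn_trans _) ->.
have xn : (x.-1 < n)%N by rewrite prednK // -ltnS.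
have xab' : (ab.1 <= Ordinal xn < ab.2)%N by rewrite /= prednK // -ltnS prednK.
split=> //.
have /implyP/(_ xab')/eqP <- := all (Ordinal xn).
by rewrite -is_right_ord.
Qed.

Lemma row_labelsE :
  row_labels Q = run_heads true ++ [:: ord_max] ++ rev (run_heads false).
Proof.
rewrite /row_labels /run_heads rev_flatten -!map_comp; congr (_ ++ (_ ++ flatten _)).
rewrite !map_rev -!map_comp; congr rev; apply: eq_map => ab /=; exact: drop_start_rev.
Qed.

Lemma col_labelsE :
  col_labels Q = rev (run_tails false) ++ [:: ord0] ++ run_tails true.
Proof.
rewrite /col_labels /run_tails rev_flatten -!map_comp; congr (flatten _ ++ (_ ++ _)).
rewrite !map_rev -!map_comp; congr rev; apply: eq_map => ab /=; exact: drop_end_rev.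
Qed.

Lemma row_labels_sorted :
  sorted (fun x y : 'I_n.+1 => row_key x < row_key y) (row_labels Q).
Proof.
rewrite sorted_pairwise; last by move=> x y z; exact: ltn_trans.
have [srt prt] := run_headsP true; have [slf plf] := run_headsP false.
have keyn : row_key n = n by rewrite /row_key is_right_out.
rewrite row_labelsE !pairwise_cat pairwise_rev allrel_catr allrel1r allrel1l -!andbA.
apply/and5P; split=> //.
- by apply/allP=> x /prt[xn xr]; rewrite /= keyn /row_key xr.
- apply/allrelP=> x y; rewrite mem_rev => /prt[xn xr] /plf[yn yr] /=.
  by rewrite /row_key xr yr; lia.
- apply: sub_pairwise_in srt.
  by move=> x y /prt[xn xr] /prt[yn yr] /=; rewrite /row_key xr yr.
- by apply/allP => x; rewrite mem_rev /= => /plf[xn xr]; rewrite keyn /row_key xr; lia.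
- rewrite /=; apply: sub_pairwise_in slf.
  by move=> x y /plf[xn xr] /plf[yn yr] /=; rewrite /row_key xr yr; lia.
Qed.

Lemma col_labels_sorted :
  sorted (fun x y : 'I_n.+1 => col_key x < col_key y) (col_labels Q).
Proof.
rewrite sorted_pairwise; last by move=> x y z; exact: ltn_trans.
have [srt prt] := run_tailsP true; have [slf plf] := run_tailsP false.
rewrite col_labelsE !pairwise_cat pairwise_rev allrel_catr allrel1r allrel1l -!andbA.
apply/and5P; split=> //.
- apply/allP=> x; rewrite mem_rev => /plf[xn xr]; have := ltn_ord x.
  by rewrite /= /col_key /= xr; case: eqP => /=; lia.
- apply/allrelP=> x y; rewrite mem_rev => /plf[xn xr] /prt[yn yr] /=; have := ltn_ord x.
  by rewrite /col_key xr yr; case: eqP; case: eqP => /=; lia.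
- apply: sub_pairwise_in slf.
  move=> x y /plf[xn xr] /plf[yn yr] /=; have := ltn_ord x; have := ltn_ord y.
  by rewrite /col_key xr yr; case: eqP; case: eqP => /=; lia.
- by apply/allP => x /= /prt[xn xr]; rewrite /col_key /= xr; case: eqP => /=; lia.
- rewrite /=; apply: sub_pairwise_in srt.
  by move=> x y /prt[xn xr] /prt[yn yr] /=; rewrite /col_key xr yr !orbT; lia.
Qed.

Lemma preceq_key (key : nat -> nat) (s : seq 'I_n.+1) x y :
  perm_eq s (enum 'I_n.+1) -> sorted (fun x y : 'I_n.+1 => key x < key y) s ->
  preceq s x y = (key x <= key y)%N.
Proof.
move=> sperm ssort; rewrite /preceq.
have mem_s z : z \in s by rewrite (perm_mem sperm) mem_enum.
have tr : transitive (fun x y : 'I_n.+1 => key x < key y).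
  by move=> ? ? ?; exact: ltn_trans.
have lt := sorted_ltn_index tr ssort.
case: (ltngtP (index x s) (index y s)) => [/lt|/lt|].
- by move=> /(_ (mem_s _) (mem_s _))/ltnW ->.
- by move=> /(_ (mem_s _) (mem_s _)) /=; rewrite ltnNge => /negbTE ->.
- by move=> /(congr1 (nth x s)); rewrite !nth_index // => ->; rewrite leqnn.
Qed.

Lemma preceq_row x y : preceq (row_labels Q) x y = (row_key x <= row_key y)%N.
Proof. exact: preceq_key (perm_row_labels Q) row_labels_sorted. Qed.

Lemma preceq_col x y : preceq (col_labels Q) x y = (col_key x <= col_key y)%N.
Proof. exact: preceq_key (perm_col_labels Q) col_labels_sorted. Qed.

End Order.

Local Open Scope ring_scope.

(** * Ranks of submatrices and triangular factors *)

Section Rank.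
Variable k : fieldType.

(** If [A] is [B] with rows and columns repeated, deleted, or inserted as zero
    rows and columns, then [A] is a product of [B] with two matrices of zeros and
    ones.  This serves to pass to submatrices and to change index sets. *)
Lemma mxrank_partial_reindex p q p' q' (A : 'M[k]_(p, q)) (B : 'M[k]_(p', q'))
    (f : 'I_p -> option 'I_p') (g : 'I_q -> option 'I_q') :
  (forall i j, A i j = if f i is Some i' then if g j is Some j' then B i' j' else 0
                       else 0) ->
  (\rank A <= \rank B)%N.
Proof.
move=> AE.
have -> : A = (\matrix_(i, i') (f i == Some i')%:R) *m B
              *m (\matrix_(j', j) (g j == Some j')%:R).
  apply/matrixP=> i j; rewrite AE !mxE.
  under eq_bigr do rewrite !mxE.
  case: (g j) => [j'|]; last first.
    by rewrite big1 => [|j' _]; [case: (f i) | rewrite mulr0].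
  rewrite (bigD1 j') //= eqxx mulr1 [X in _ + X]big1 ?addr0; last first.
    by move=> j'' ne; rewrite (inj_eq Some_inj) eq_sym (negbTE ne) mulr0.
  under eq_bigr do rewrite mxE.
  case: (f i) => [i'|]; last by rewrite big1 // => i' _; rewrite mul0r.
  rewrite (bigD1 i') //= eqxx mul1r [X in _ + X]big1 ?addr0 // => i'' ne.
  by rewrite (inj_eq Some_inj) eq_sym (negbTE ne) mul0r.
exact: leq_trans (mxrankM_maxl _ _) (mxrankM_maxr _ _).
Qed.

(** Masking keeps the size of a matrix, so that restricted matrices can be
    multiplied without re-indexing. *)
Definition rect_mask p q (I : pred 'I_p) (J : pred 'I_q) (A : 'M[k]_(p, q)) :=
  \matrix_(i, j) if I i && J j then A i j else 0.

Lemma mxrank_submx p q (I : {set 'I_p}) (J : {set 'I_q}) (A : 'M[k]_(p, q)) :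
  \rank (submx_of I J A) = \rank (rect_mask (fun i => i \in I) (fun j => j \in J) A).
Proof.
apply/eqP; rewrite eqn_leq; apply/andP; split.
  apply: (@mxrank_partial_reindex _ _ _ _ _ _ (Some \o enum_val) (Some \o enum_val)).
  by move=> i j; rewrite mxE /= mxE !enum_valP.
apply: (@mxrank_partial_reindex _ _ _ _ _ _
  (fun i => [pick i' | enum_val i' == i]) (fun j => [pick j' | enum_val j' == j])).
have pickE r (K : {set 'I_r}) (i : 'I_r) :
    if [pick i' : 'I_#|K| | enum_val i' == i] is Some i' then i \in K /\ enum_val i' = i
    else i \notin K.
  case: pickP => [i' /eqP <-|none]; first by split=> //; exact: enum_valP.
  by apply/negP => iK; have /eqP[] := none (enum_rank_in iK i); rewrite enum_rankK_in.
move=> i j; rewrite mxE /=; have := pickE _ I i; have := pickE _ J j.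
case: [pick _ | _] => [j' [jJ ej]|/negbTE jJ]; last first.
  by case: [pick _ | _] => [? _|_]; rewrite jJ andbF.
case: [pick _ | _] => [i' [iI ei]|/negbTE ->] //.
by rewrite iI jJ mxE ei ej.
Qed.

(** Reindexed by its nonzero entries, a partial permutation matrix is an
    identity matrix. *)
Lemma mxrank_partial_perm p q (R : 'I_p -> 'I_q -> bool) :
  (forall i j j', R i j -> R i j' -> j = j') ->
  (forall i i' j, R i j -> R i' j -> i = i') ->
  \rank (\matrix_(i, j) (R i j)%:R : 'M[k]_(p, q))
    = #|[set ij : 'I_p * 'I_q | R ij.1 ij.2]|.
Proof.
move=> Rr Rc; set E := [set ij | _]; rewrite -[RHS](mxrank1 k).
have EP (e : 'I_#|E|) : R (enum_val e).1 (enum_val e).2.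
  by have := enum_valP e; rewrite inE.
have Einj1 (e e' : 'I_#|E|) : (enum_val e).1 = (enum_val e').1 -> e = e'.
  move=> h; apply: enum_val_inj; move: (EP e) (EP e') h.
  case: (enum_val e) (enum_val e') => [a b] [a' b'] /= h h' eq; subst a'.
  by rewrite (Rr _ _ _ h h').
have Einj2 (e e' : 'I_#|E|) : (enum_val e).2 = (enum_val e').2 -> e = e'.
  move=> h; apply: enum_val_inj; move: (EP e) (EP e') h.
  case: (enum_val e) (enum_val e') => [a b] [a' b'] /= h h' eq; subst b'.
  by rewrite (Rc _ _ _ h h').
apply/eqP; rewrite eqn_leq; apply/andP; split; last first.
  apply: (@mxrank_partial_reindex _ _ _ _ _ _ (fun e : 'I_#|E| => Some (enum_val e).1)
    (fun e => Some (enum_val e).2)) => e e'; rewrite !mxE; congr _%:R.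
  congr nat_of_bool; apply/eqP/idP => [->|]; first exact: EP.
  by move=> h; apply: Einj2; apply: Rr h; exact: EP.
apply: (@mxrank_partial_reindex _ _ _ _ _ _
  (fun i => [pick e : 'I_#|E| | (enum_val e).1 == i])
  (fun j => [pick e : 'I_#|E| | (enum_val e).2 == j])) => i j.
rewrite mxE; case: pickP => [e /eqP ei|none]; last first.
  case: (boolP (R i j)) => // Rij.
  have ijE : (i, j) \in E by rewrite inE.
  by have := none (enum_rank_in ijE (i, j)); rewrite enum_rankK_in //= eqxx.
case: pickP => [e' /eqP ej|none]; last first.
  case: (boolP (R i j)) => // Rij.
  have ijE : (i, j) \in E by rewrite inE.
  by have := none (enum_rank_in ijE (i, j)); rewrite enum_rankK_in //= eqxx.
rewrite mxE; congr (nat_of_bool _)%:R; apply/idP/eqP => [|ee].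
  by rewrite -ei => h; apply: Einj2; rewrite ej; apply: Rr h; exact: EP.
by rewrite -ei -ej ee; exact: EP.
Qed.

(** In the expansion of the determinant a permutation contributes only if it
    does not decrease the key anywhere; as it preserves the sum of all keys, it
    is then the identity. *)
Lemma unitmx_triangular m (key : 'I_m -> nat) (T : 'M[k]_m) :
  injective key -> (forall i j, T i j != 0 -> (key i <= key j)%N) ->
  (forall i, T i i != 0) -> T \in unitmx.
Proof.
move=> inj tri diag; rewrite unitmxE unitfE /determinant (bigD1 1%g) //=.
rewrite [X in _ + X]big1 => [|s s1].
  rewrite odd_perm1 expr0 mul1r addr0; apply/prodf_neq0 => i _.
  by rewrite perm1; exact: diag.
suff /exists_inP[i _ /eqP Ti0] : [exists i in 'I_m, T i (s i) == 0].
  by rewrite (bigD1 i) //= Ti0 mul0r mulr0.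
apply: contraNT s1; rewrite negb_exists_in => /forall_inP nz.
have le i : (key i <= key (s i))%N by apply: tri; exact: nz.
have sumE : (\sum_i key i = \sum_i key (s i))%N.
  by rewrite (reindex_inj (@perm_inj _ s)).
have eqk : forall i, key i = key (s i).
  move=> i; apply/eqP; move: sumE; rewrite (bigD1 i) //= [RHS](bigD1 i) //=.
  have : (\sum_(j | j != i) key j <= \sum_(j | j != i) key (s j))%N by apply: leq_sum.
  rewrite eqn_leq le /= => le_rest eq_tot.
  by rewrite -(leq_add2r (\sum_(j | j != i) key j)) eq_tot leq_add2l.
by apply/eqP/permP => i; rewrite perm1; apply: inj; rewrite -eqk.
Qed.

(** A row of [L] with index in the final segment [I] vanishes outside [I].  So
    masking [L *m C] amounts to masking [C] first and multiplying by the
    restriction of [L] to [I], extended by the identity to an invertible matrix;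
    likewise for the columns. *)
Lemma mxrank_rect_mask_triangular p q (keyr : 'I_p -> nat) (keyc : 'I_q -> nat)
    (I : pred 'I_p) (J : pred 'I_q)
    (L : 'M[k]_p) (U : 'M[k]_q) (C : 'M[k]_(p, q)) :
  injective keyr -> injective keyc ->
  (forall i i', I i -> keyr i <= keyr i' -> I i')%N ->
  (forall j j', J j -> keyc j' <= keyc j -> J j')%N ->
  (forall i i', L i i' != 0 -> (keyr i <= keyr i')%N) -> (forall i, L i i != 0) ->
  (forall j j', U j j' != 0 -> (keyc j <= keyc j')%N) -> (forall j, U j j != 0) ->
  \rank (rect_mask I J (L *m C *m U)) = \rank (rect_mask I J C).
Proof.
move=> injr injc upI downJ Ltri Ldiag Utri Udiag.
(* L' and U' are the restrictions of L and U to I and J, completed by 1. *)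
pose L' := \matrix_(i, i') if I i then L i i' else (i == i')%:R.
pose U' := \matrix_(j, j') if J j' then U j j' else (j == j')%:R.
have Lu : L' \in unitmx.
  apply: (unitmx_triangular injr) => [i i'|i]; rewrite mxE;
    case: ifP => // _; rewrite ?eqxx ?oner_neq0 //.
    exact: Ltri.
  by have [->|_] := eqVneq i i'; rewrite ?eqxx.
have Uu : U' \in unitmx.
  apply: (unitmx_triangular injc) => [j j'|j]; rewrite mxE;
    case: ifP => // _; rewrite ?eqxx ?oner_neq0 //.
    exact: Utri.
  by have [->|_] := eqVneq j j'; rewrite ?eqxx.
have -> : rect_mask I J (L *m C *m U) = L' *m rect_mask I J C *m U'.
  apply/matrixP=> i j; rewrite !mxE; case: (boolP (I i)) => Ii /=; last first.
    rewrite big1 // => j' _; rewrite !mxE big1 ?mul0r // => i' _.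
    rewrite !mxE (negbTE Ii).
    by have [<-|_] := eqVneq i i'; rewrite ?(negbTE Ii) ?mulr0 // mul0r.
  case: (boolP (J j)) => Jj; last first.
    rewrite big1 // => j' _; rewrite !mxE (negbTE Jj).
    have [ej|_] := eqVneq j' j; last by rewrite mulr0.
    by rewrite big1 ?mul0r // => i' _; rewrite !mxE ej (negbTE Jj) andbF mulr0.
  apply: eq_bigr => j' _; rewrite !mxE Jj.
  have [->|Unz] := eqVneq (U j' j) 0; first by rewrite !mulr0.
  have Jj' : J j' := downJ _ _ Jj (Utri _ _ Unz).
  congr (_ * _); apply: eq_bigr => i' _; rewrite !mxE Ii Jj' andbT.
  have [->|Lnz] := eqVneq (L i i') 0; first by rewrite !mul0r.
  by rewrite (upI _ _ Ii (Ltri _ _ Lnz)).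
rewrite mxrankMfree ?row_free_unit // -mxrank_tr trmx_mul.
by rewrite mxrankMfree ?mxrank_tr // row_free_unit unitmx_tr.
Qed.

End Rank.

(** * Ranks of block matrices *)

Section BlockDiagonal.
Variable k : fieldType.

(** The rectangular analogue of [mxdiag]. *)
Definition block_diag m (p q : 'I_m -> nat) (g : forall i, 'M[k]_(p i, q i)) :
    'M[k]_(\sum_i p i, \sum_i q i) :=
  \mxblock_(i, j) (if i == j then conform_mx 0 (g i) else 0 : 'M[k]_(p i, q j)).

Lemma mul_block_diag_mxblock m m' (p q : 'I_m -> nat) (r : 'I_m' -> nat)
    (g : forall i, 'M[k]_(p i, q i)) (F : forall i j, 'M[k]_(q i, r j)) :
  block_diag g *m \mxblock_(i, j) F i j = \mxblock_(i, j) (g i *m F i j).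
Proof.
rewrite mul_mxblock; apply: eq_mxblock => i j.
rewrite (bigD1 i) //= eqxx conform_mx_id big1 ?addr0 // => i' ne.
by rewrite eq_sym (negbTE ne) mul0mx.
Qed.

Lemma mul_mxblock_block_diag m m' (p q : 'I_m -> nat) (r : 'I_m' -> nat)
    (g : forall i, 'M[k]_(p i, q i)) (F : forall i j, 'M[k]_(r i, p j)) :
  \mxblock_(i, j) F i j *m block_diag g = \mxblock_(i, j) (F i j *m g j).
Proof.
rewrite mul_mxblock; apply: eq_mxblock => i j.
rewrite (bigD1 j) //= eqxx conform_mx_id big1 ?addr0 // => i' ne.
by rewrite (negbTE ne) mulmx0.
Qed.

Lemma mxrank_mxblock_mul m m' (p p' : 'I_m -> nat) (q q' : 'I_m' -> nat)
    (g : forall i, 'M[k]_(p i, p' i)) (h : forall j, 'M[k]_(q' j, q j))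
    (F : forall i j, 'M[k]_(p' i, q' j)) :
  (\rank (\mxblock_(i, j) (g i *m F i j *m h j)) <= \rank (\mxblock_(i, j) F i j))%N.
Proof.
rewrite -(mul_mxblock_block_diag h (fun i j => g i *m F i j)) -mul_block_diag_mxblock.
exact: leq_trans (mxrankM_maxl _ _) (mxrankM_maxr _ _).
Qed.

(** Block-diagonal matrices made of the inclusions and projections of the two
    summands carry one side to the block sum of the two matrices, and back. *)
Lemma mxrank_mxblock_dsum m m' (p p' : 'I_m -> nat) (q q' : 'I_m' -> nat)
    (F : forall i j, 'M[k]_(p i, q j)) (G : forall i j, 'M[k]_(p' i, q' j)) :
  \rank (\mxblock_(i, j) block_mx (F i j) 0 0 (G i j))
    = (\rank (\mxblock_(i, j) F i j) + \rank (\mxblock_(i, j) G i j))%N.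
Proof.
rewrite -rank_diag_block_mx.
pose X1 := block_diag (fun i : 'I_m => row_mx 1%:M 0 : 'M[k]_(p i, p i + p' i)).
pose X2 := block_diag (fun i : 'I_m => row_mx 0 1%:M : 'M[k]_(p' i, p i + p' i)).
pose Y1 := block_diag (fun i : 'I_m' => row_mx 1%:M 0 : 'M[k]_(q i, q i + q' i)).
pose Y2 := block_diag (fun i : 'I_m' => row_mx 0 1%:M : 'M[k]_(q' i, q i + q' i)).
pose Xt1 := block_diag (fun i : 'I_m => col_mx 1%:M 0 : 'M[k]_(p i + p' i, p i)).
pose Xt2 := block_diag (fun i : 'I_m => col_mx 0 1%:M : 'M[k]_(p i + p' i, p' i)).
pose Yt1 := block_diag (fun i : 'I_m' => col_mx 1%:M 0 : 'M[k]_(q i + q' i, q i)).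
pose Yt2 := block_diag (fun i : 'I_m' => col_mx 0 1%:M : 'M[k]_(q i + q' i, q' i)).
set Z := \mxblock_(i, j) block_mx _ _ _ _; set A := \mxblock_(i, j) F i j.
set B := \mxblock_(i, j) G i j.
have ZE : Z = row_mx Xt1 Xt2 *m block_mx A 0 0 B *m col_mx Y1 Y2.
  rewrite mul_row_block !mulmx0 addr0 add0r mul_row_col.
  rewrite !mul_block_diag_mxblock !mul_mxblock_block_diag -mxblockD.
  apply: eq_mxblock => i j.
  rewrite !mul_col_mx !mul_mx_row !mul1mx !mul0mx !mulmx1 !mulmx0.
  by rewrite add_col_mx !add_row_mx !addr0 !add0r.
have BE : block_mx A 0 0 B = col_mx X1 X2 *m Z *m row_mx Yt1 Yt2.
  rewrite mul_col_mx mul_col_row /X1 /X2 /Yt1 /Yt2.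
  rewrite !mul_block_diag_mxblock !mul_mxblock_block_diag.
  congr block_mx; rewrite -?[0 in LHS]mxblock0; apply: eq_mxblock => i j;
  by rewrite mul_row_block mul_row_col !mul1mx !mul0mx !mulmx1 !mulmx0
     ?addr0 ?add0r ?mulmx1 ?mulmx0.
apply/eqP; rewrite eqn_leq {1}ZE BE !(leq_trans (mxrankM_maxl _ _) (mxrankM_maxr _ _)).
by [].
Qed.

End BlockDiagonal.

(** * Functoriality of the Zelevinsky blocks *)

Section Functoriality.
Variables (k : fieldType) (n : nat) (Q : quiverA n).
Implicit Types (d : 'I_n.+1 -> nat) (x y : 'I_n.+1).

(** Each block is zero, an identity, or a composition of the matrices of [V]
    along a path, and the choice depends on the quiver alone. *)
Lemma zelevinsky_block_natural d d' (V : rep k Q d) (W : rep k Q d')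
    (g : forall x, 'M[k]_(d' x, d x)) :
  (forall e, g (tgt Q e) *m V e = W e *m g (src Q e)) ->
  forall x y, g x *m zelevinsky_block V x y = zelevinsky_block W x y *m g y.
Proof.
move=> gVW.
have arrowE x y : g x *m arrow_mx V x y = arrow_mx W x y *m g y.
  rewrite mulmx_sumr mulmx_suml; apply: eq_bigr => e /andP[/eqP <- /eqP <-].
  by rewrite !conform_mx_id.
have idE x y : x = y ->
    g x *m (conform_mx 0 (1%:M : 'M_(d x)) : 'M_(d x, d y))
      = conform_mx 0 (1%:M : 'M_(d' x)) *m g y.
  by move=> <-; rewrite !conform_mx_id mulmx1 mul1mx.
have compE x s y : g x *m comp_mx V x y s = comp_mx W x y s *m g y.
  elim: s y => [|z s IH] y /=; last by rewrite mulmxA IH -!mulmxA arrowE.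
  by case: eqP => [/idE //|_]; rewrite mulmx0 mul0mx.
move=> x y; rewrite /zelevinsky_block; case: eqP => [/idE //|_].
case: ifP => _; first by rewrite mulmx0 mul0mx.
case: ifP => _; first exact: arrowE.
by case: ifP => _; [rewrite mulmx0 mul0mx | exact: compE].
Qed.

(** A consequence of naturality with respect to the inclusions of the two
    summands. *)
Lemma zelevinsky_block_dsum d d' (V : rep k Q d) (W : rep k Q d') x y :
  zelevinsky_block (dsum_rep V W) x y
    = block_mx (zelevinsky_block V x y) 0 0 (zelevinsky_block W x y).
Proof.
set Z := zelevinsky_block (dsum_rep V W) x y.
have Zl : Z *m col_mx 1%:M 0 = col_mx 1%:M 0 *m zelevinsky_block V x y.
  rewrite -(@zelevinsky_block_natural _ _ V (dsum_rep V W) (fun=> col_mx 1%:M 0)) // => e.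
  by rewrite /dsum_rep mul_block_col mul_col_mx !mul1mx !mul0mx !mulmx0 !mulmx1 !addr0.
have Zr : Z *m col_mx 0 1%:M = col_mx 0 1%:M *m zelevinsky_block W x y.
  rewrite -(@zelevinsky_block_natural _ _ W (dsum_rep V W) (fun=> col_mx 0 1%:M)) // => e.
  by rewrite /dsum_rep mul_block_col mul_col_mx !mul1mx !mul0mx !mulmx0 !mulmx1 !add0r.
rewrite -[LHS]mulmx1 scalar_mx_block -[block_mx 1%:M _ _ _]/(col_mx (row_mx _ _) (row_mx _ _)).
rewrite -block_mxEv block_mxEh mul_mx_row Zl Zr !mul_col_mx !mul1mx !mul0mx.
by rewrite block_mxEh.
Qed.

Definition zelevinsky_rank d (V : rep k Q d) (I J : pred 'I_n.+1) : nat :=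
  \rank (blocked_mx (row_labels Q) (col_labels Q)
           (fun x y => if I x && J y then zelevinsky_block V x y else 0)).

Lemma zelevinsky_rank_iso d d' (V : rep k Q d) (W : rep k Q d') I J :
  rep_iso V W -> zelevinsky_rank V I J = zelevinsky_rank W I J.
Proof.
suff le d1 d2 (V1 : rep k Q d1) (V2 : rep k Q d2)
    (g : forall x, 'M_(d2 x, d1 x)) (h : forall x, 'M_(d1 x, d2 x)) :
    (forall x, h x *m g x = 1%:M) ->
    (forall e, g (tgt Q e) *m V1 e = V2 e *m g (src Q e)) ->
    (zelevinsky_rank V1 I J <= zelevinsky_rank V2 I J)%N.
  move=> [g [h [hg gVW]]]; apply/eqP; rewrite eqn_leq; apply/andP; split.
    by apply: (le _ _ _ _ g h) => // x; case: (hg x).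
  apply: (le _ _ _ _ h g) => [x|e]; first by case: (hg x).
  have [_ gh] := hg (src Q e); have [hg' _] := hg (tgt Q e).
  by rewrite -[LHS]mulmx1 -gh mulmxA -(mulmxA (h _)) -gVW !mulmxA hg' mul1mx.
move=> hg gV.
pose F := fun x y => if I x && J y then zelevinsky_block V2 x y else 0.
apply: leq_trans (mxrank_mxblock_mul (fun i => h (tnth (in_tuple (row_labels Q)) i))
  (fun j => g (tnth (in_tuple (col_labels Q)) j)) (fun i j => F _ _)).
rewrite eq_leq //; congr mxrank; apply: eq_mxblock => i j; rewrite /F.
case: ifP => _; last by rewrite mulmx0 mul0mx.
by rewrite -mulmxA -(zelevinsky_block_natural gV) mulmxA hg mul1mx.
Qed.

Lemma zelevinsky_rank_dsum d d' (V : rep k Q d) (W : rep k Q d') I J :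
  zelevinsky_rank (dsum_rep V W) I J
    = (zelevinsky_rank V I J + zelevinsky_rank W I J)%N.
Proof.
rewrite -mxrank_mxblock_dsum; congr mxrank; apply: eq_mxblock => i j.
case: ifP => _; first exact: zelevinsky_block_dsum.
by rewrite block_mx0.
Qed.

Lemma zelevinsky_rank_zero I J : zelevinsky_rank (zero_rep k Q) I J = 0%N.
Proof.
apply/eqP; rewrite mxrank_eq0; apply/eqP; rewrite -[RHS]mxblock0.
by apply: eq_mxblock => i j; apply/matrixP => -[].
Qed.

Lemma zelevinsky_rank_indecs_sum s I J :
  zelevinsky_rank (indecs_sum k Q s) I J
    = (\sum_(pq <- s) zelevinsky_rank (@indec k n Q pq.1 pq.2) I J)%N.
Proof.
elim: s => [|pq s IH]; first by rewrite big_nil zelevinsky_rank_zero.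
by rewrite big_cons -IH -zelevinsky_rank_dsum.
Qed.

End Functoriality.

(** * The Zelevinsky blocks of an indecomposable representation *)

Section Entries.
Variables (n : nat) (Q : quiverA n).
Implicit Types (x y z p q : 'I_n.+1).

Definition right_path (y x : nat) := (y <= x)%N && all (is_right Q) (iota y (x - y)).

Lemma arrow_up y z : z = y.+1 :> nat -> arrow Q y z = is_right Q y.
Proof.
move=> zy; have yn : (y < n)%N by rewrite -ltnS -zy.
rewrite (_ : (y : nat) = Ordinal yn) // is_right_ord.
apply/existsP/idP => [[e]|Qy].
  rewrite /src /tgt -!val_eqE /= zy; case: ifP => /= Qe /andP[/eqP sy /eqP tz].
    by rewrite (_ : Ordinal yn = e) //; exact/val_inj.
  by move: sy tz => /=; rewrite /bump /=; lia.
by exists (Ordinal yn); rewrite /src /tgt Qy -!val_eqE /= /bump /= add1n zy !eqxx.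
Qed.

Lemma arrow_down y z : y = z.+1 :> nat -> arrow Q y z = ~~ is_right Q z.
Proof.
move=> yz; have zn : (z < n)%N by rewrite -ltnS -yz.
rewrite (_ : (z : nat) = Ordinal zn) // is_right_ord.
apply/existsP/idP => [[e]|Qz].
  rewrite /src /tgt -!val_eqE /= yz; case: ifP => /= Qe /andP[/eqP sy /eqP tz].
    by move: sy tz => /=; rewrite /bump /=; lia.
  by rewrite (_ : Ordinal zn = e) ?Qe //; exact/val_inj.
by exists (Ordinal zn); rewrite /src /tgt (negbTE Qz) -!val_eqE /= /bump /= add1n yz !eqxx.
Qed.

Lemma last_iota m l : last m (iota m.+1 l) = (m + l)%N.
Proof. by elim: l m => [|l IH] m /=; rewrite ?addn0 // IH addSnnS. Qed.

Lemma map_val_steps y x : (y <= x)%N -> map val (steps y x) = iota y.+1 (x - y).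
Proof. by move=> yx; rewrite /steps yx -behead_map map_val_interval. Qed.

Lemma has_path_right y x : (y <= x)%N -> has_path Q y x = right_path y x.
Proof.
move=> yx; rewrite /right_path yx /= /has_path; move: (map_val_steps yx).
move: (x - y)%N (steps y x) => m s.
elim: m s y {yx} => [|m IH] s y; case: s => [|z s] //= [zy es].
by rewrite (arrow_up zy) IH zy.
Qed.

Lemma has_path_left y x : y = x.+1 :> nat -> has_path Q y x = ~~ is_right Q x.
Proof.
move=> yx; have xy : (x <= y)%N by rewrite yx.
have ex : Defs.interval x y = [:: x; y].
  apply: (inj_map val_inj); rewrite map_val_interval // yx subSnn /=; by rewrite -yx.
by rewrite /has_path /steps leqNgt yx ltnSn /= ex /= andbT arrow_down.
Qed.

Variable k : fieldType.

Lemma arrow_mx_indec p q x y i j :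
  arrow_mx (@indec k n Q p q) x y i j = (arrow Q y x)%:R.
Proof.
rewrite /arrow_mx summxE (eq_bigr (fun=> 1)); last first.
  move=> e /andP[/eqP ey /eqP ex]; case: _ / ey i j; case: _ / ex => i j.
  by rewrite conform_mx_id mxE.
rewrite sumr_const; congr _%:R; rewrite /arrow.
case: existsP => [[e he]|none]; last first.
  by apply: eq_card0 => e; apply/negP => he; apply: none; exists e.
rewrite (@eq_card1 _ e) // => e'; apply/idP/eqP => [he'|-> //].
move: he he' => /andP[/eqP <- /eqP <-] /andP[].
rewrite /src /tgt -!val_eqE; case: ifP => _; case: ifP => _ /= /eqP h1 /eqP h2;
  by apply/val_inj => /=; move: h1 h2; rewrite /bump /=; lia.
Qed.

(** The composition passes through a zero space as soon as the path leaves
    the support of [I_pq]. *)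
Lemma comp_mx_indec p q x s y i j :
  comp_mx (@indec k n Q p q) x y s i j
   = [&& path (arrow Q) y s, last y s == x &
        all (fun z : 'I_n.+1 => (p <= z <= q)%N) s]%:R.
Proof.
elim: s y j => [|z s IH] y j /=.
  rewrite andbT eq_sym; case: eqP => [exy|_]; last by rewrite mxE.
  case: _ / exy i => i; rewrite conform_mx_id mxE; congr (nat_of_bool _)%:R.
  apply/eqP/val_inj => /=; case: i j => [i hi] [j hj] /=.
  move: hi hj; rewrite /indec_dim; case: (_ && _) => //; lia.
rewrite mxE; under eq_bigr do rewrite IH arrow_mx_indec -natrM mulnb.
rewrite sumr_const card_ord -mulrnA /indec_dim mulnb; congr (nat_of_bool _)%:R.
by rewrite -!andbA; do !bool_congr.
Qed.

Lemma zelevinsky_block_indec p q x y i j :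
  zelevinsky_block (@indec k n Q p q) x y i j
   = (right_path y x || (y == x.+1 :> nat) && ~~ is_right Q x)%:R.
Proof.
have in_support z : 'I_(indec_dim p q z) -> (p <= z <= q)%N.
  by rewrite /indec_dim; case: (_ && _) => // -[].
have xpq := in_support _ i; have ypq := in_support _ j.
rewrite /zelevinsky_block; case: eqP => [exy|ne].
  case: _ / exy j ypq => j _; rewrite conform_mx_id mxE /right_path subnn leqnn /=.
  suff -> : i == j by [].
  apply/eqP/val_inj => /=; case: i j => [i hi] [j hj] /=.
  move: hi hj; rewrite /indec_dim; case: (_ && _) => //; lia.
case: (leqP y x) => yx.
  have lt_yx : (y < x)%N.
    by rewrite ltn_neqAle yx andbT; apply/eqP => h; apply: ne; exact/val_inj.
  rewrite has_path_right // ltn_eqF ?ltnS //= orbF.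
  case: (boolP (right_path y x)) => [rp|_]; last by rewrite mxE.
  rewrite /= [(x.+1 < y)%N]ltnNge leqW //=.
  rewrite comp_mx_indec -/(has_path Q y x) has_path_right // rp /=.
  have stepsE := map_val_steps yx.
  have -> : last y (steps y x) == x.
    by rewrite -val_eqE /= -[val (last _ _)]last_map stepsE last_iota subnKC.
  suff -> : all (fun z : 'I_n.+1 => (p <= z <= q)%N) (steps y x) by [].
  apply/allP => z zs; have : val z \in map val (steps y x).
    by rewrite mem_map //; exact: val_inj.
  rewrite stepsE mem_iota /=; lia.
have -> : right_path y x = false by rewrite /right_path leqNgt yx.
case: eqP => [e|ne'] /=.
  rewrite has_path_left // negbK; case: ifP => xr; first by rewrite mxE.
  by rewrite arrow_mx_indec arrow_down // xr.
have -> : (x.+1 < y)%N by rewrite ltn_neqAle yx andbT eq_sym; apply/eqP.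
by case: ifP; rewrite mxE.
Qed.

End Entries.

(** * The triangular factorization for an indecomposable representation *)

Section Factor.
Variables (k : fieldType) (n : nat) (Q : quiverA n).

Local Notation rt := (is_right Q).
Local Notation rp := (right_path Q).

Lemma right_pathxx x : rp x x.
Proof. by rewrite /right_path subnn leqnn. Qed.

Lemma right_path_le y x : rp y x -> (y <= x)%N.
Proof. by case/andP. Qed.

Lemma right_path_gt y x : (x < y)%N -> rp y x = false.
Proof. by move=> xy; rewrite /right_path leqNgt xy. Qed.

Lemma right_path_step y x : (y < x)%N -> rp y x = rt y && rp y.+1 x.
Proof. by move=> yx; rewrite /right_path yx ltnW // -(subnSK yx). Qed.

(** The change of sign of the basis vectors which makes left arrows act by -1
    and leaves right arrows unchanged. *)
Definition left_sign (x : nat) : k := (-1) ^+ count (fun e => ~~ rt e) (iota 0 x).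

Lemma left_signS x : left_sign x.+1 = if rt x then left_sign x else - left_sign x.
Proof.
rewrite /left_sign -addn1 iotaD count_cat /= exprD !add0n addn0.
by case: (rt x); rewrite ?mulr1 // mulrN1.
Qed.

Lemma left_sign_neq0 x : left_sign x != 0.
Proof. by rewrite expf_neq0 // oppr_eq0 oner_eq0. Qed.

Lemma left_sign_sqr x : left_sign x * left_sign x = 1.
Proof. by rewrite -expr2 sqrr_sign. Qed.

Lemma left_sign_right_path y x : rp y x -> left_sign y = left_sign x.
Proof.
move=> /andP[yx]; rewrite -{2}(subnKC yx).
move: (x - y)%N => m {yx}; elim: m y => [|m IH] y /=; first by rewrite addn0.
by move=> /andP[ry /IH]; rewrite left_signS ry addSnnS.
Qed.

(** The entry at ([x], [y]) of the Zelevinsky matrix of [I_pq]. *)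
Definition indec_entry (y x : nat) := rp y x || (y == x.+1) && ~~ rt x.

Lemma left_sign_entry x y :
  left_sign x * ((rp y x)%:R - ((y == x.+1) && ~~ rt x)%:R) * left_sign y
    = (indec_entry y x)%:R.
Proof.
rewrite /indec_entry; case: (boolP (rp y x)) => [ryx|_] /=.
  rewrite (left_sign_right_path ryx) ltn_eqF ?ltnS ?right_path_le //= subr0 mulr1.
  exact: left_sign_sqr.
case: eqP => [->|_] /=; last by rewrite subr0 mulr0 mul0r.
rewrite left_signS; case: (rt x) => /=; first by rewrite subr0 mulr0 mul0r.
by rewrite sub0r mulrN1 mulrNN left_sign_sqr.
Qed.

Variables (p q : 'I_n.+1).
Hypothesis pq : (p <= q)%N.

(** In the notation of the introduction, column [z] of [row_coef] is m_p for
    [z = q] and m_(z+1) otherwise, and [col_coef z y] is the coefficient of m_z in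
    column [y] of the signed Zelevinsky matrix of [I_pq]. *)
Definition row_coef (x z : nat) : k :=
  if z == q then ((x == q) || rt x)%:R
  else (~~ rt z && rp z.+1 x)%:R - (x == z)%:R.

Definition col_coef (z y : nat) : k :=
  if (y == p) || rt y.-1 then
    if z == p then 1 else if rt z.-1 then (z <= y)%N%:R else - (y < z)%N%:R
  else (z == y)%:R.

(** The sum telescopes: lengthening a path downwards by a right arrow does not
    change whether it is a right path, while no right path crosses a left arrow. *)
Lemma sum_left_right_path a x : (a <= x)%N ->
  \sum_(a <= z < x) (~~ rt z && rp z.+1 x)%:R = 1 - (rp a x)%:R :> k.
Proof.
move=> ax.
transitivity (\sum_(a <= z < x) ((rp z.+1 x)%:R - (rp z x)%:R : k)); last first.
  by rewrite (telescope_sumr (fun z => (rp z x)%:R)) // right_pathxx.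
apply: eq_big_nat => z /andP[_ zx]; rewrite (right_path_step zx).
by case: (rt z) => /=; rewrite ?subrr ?subr0.
Qed.

(** Both sides are column [y] of the signed Zelevinsky matrix of [I_pq] at
    row [x]; [row_coef x q * col_coef p y] is the contribution of m_p.  If a left
    arrow leaves [y] downwards, only m_y contributes.  Otherwise the sum reduces
    to [sum_left_right_path] and to the single term with [z = x]. *)
Lemma factor_identity x y : (p <= x <= q)%N -> (p <= y <= q)%N ->
  row_coef x q * col_coef p y + \sum_(p <= z < q) row_coef x z * col_coef z.+1 y
    = (rp y x)%:R - ((y == x.+1) && ~~ rt x)%:R.
Proof.
move=> /andP[px xq] /andP[py yq]; rewrite {1}/row_coef eqxx {1}/col_coef.
case: ifPn => [yr|]; last first.
  rewrite negb_or => /andP[yp yl].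
  have lt_py : (p < y)%N by rewrite ltn_neqAle eq_sym yp.
  rewrite [val p == y]eq_sym (negbTE yp) mulr0 add0r.
  have y1 : y = y.-1.+1 by rewrite prednK //; lia.
  rewrite (bigD1_seq y.-1) ?iota_uniq //= ?mem_index_iota; last by lia.
  rewrite big1 ?addr0; last first.
    move=> z zy; rewrite /col_coef (negbTE yp) (negbTE yl) /=.
    have -> : (z.+1 == y) = (z == y.-1) by apply/eqP/eqP; lia.
    by rewrite (negbTE zy) mulr0.
  rewrite /col_coef (negbTE yp) (negbTE yl) /= -y1 eqxx mulr1 /row_coef ltn_eqF; last by lia.
  have -> : (y == x.+1) = (x == y.-1) by apply/eqP/eqP; lia.
  by rewrite yl -y1; case: eqP => // ->; rewrite yl.
have -> : (y == x.+1) && ~~ rt x = false.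
  apply/negP => /andP[/eqP yx xl]; move: yr.
  rewrite yx /= (negbTE xl) orbF => /eqP; lia.
rewrite eqxx mulr1 subr0.
(* s z is the coefficient, in column y, of m_(z+1). *)
pose s z : k := if rt z then (z < y)%N%:R else - (y <= z)%N%:R.
have termE z : (p <= z < q)%N ->
    row_coef x z * col_coef z.+1 y
      = - (if (y <= z < x)%N then (~~ rt z && rp z.+1 x)%:R else 0)
        - (if z == x then s x else 0).
  move=> /andP[pz zq]; rewrite /row_coef /col_coef yr (ltn_eqF zq) (@gtn_eqF p z.+1) //=.
  rewrite [if rt z then _ else _]/(s z) mulrBl.
  rewrite [x == z]eq_sym; congr (_ - _); last first.
    by case: eqP => [->|_]; rewrite ?mul1r ?mul0r.
  rewrite /s; case: (boolP (rt z)) => /= rz.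
    by rewrite mul0r; case: ifP; rewrite oppr0.
  case: (leqP y z) => yz /=; last by rewrite oppr0 mulr0.
  rewrite mulrN1; congr (- _); case: ltnP => // xz.
  by rewrite right_path_gt.
rewrite (eq_big_nat _ _ termE) big_split /= !sumrN -!big_mkcond /=.
have -> : \sum_(p <= z < q | (y <= z < x)%N) (~~ rt z && rp z.+1 x)%:R
   = (if (y <= x)%N then 1 - (rp y x)%:R else 0) :> k.
  case: leqP => yx; last first.
    rewrite big1 // => z /andP[yz zx].
    by have := leq_trans yx (leq_trans yz (ltnW zx)); rewrite ltnn.
  rewrite -sum_left_right_path // [RHS](big_nat_widenl _ p) //=.
  by rewrite [RHS](big_nat_widen _ _ q) //.
have -> : \sum_(p <= z < q | z == x) s x = if (x < q)%N then s x else 0.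
  case: ltnP => xq'.
    rewrite (big_rem x) ?mem_index_iota ?px //= eqxx big1_seq ?addr0 //.
    by move=> z /andP[/eqP ->]; rewrite mem_rem_uniq ?iota_uniq // inE eqxx.
  rewrite big_nat_cond big1 // => z /andP[/andP[_ zq] /eqP zx]; lia.
rewrite /s; case: (ltngtP x q) xq => // [xq|xq] _ /=.
  by case: (rt x); case: (leqP y x) => yx; rewrite ?(right_path_gt yx) /=; ring.
by rewrite xq yq; ring.
Qed.

Definition in_support (x : nat) := (p <= x <= q)%N.

(** Outside [p, q] the factors are completed by the identity (up to sign), to
    make them invertible on all vertices. *)
Definition row_factor : 'M[k]_n.+1 :=
  \matrix_(x, z) (left_sign x *
    (if in_support x && in_support z then row_coef x z else (x == z)%:R)).
Definition col_factor : 'M[k]_n.+1 :=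
  \matrix_(z, y) ((if in_support z && in_support y then col_coef z y
                     else (z == y)%:R) * left_sign y).

(** The matrix whose block sizes the theorem predicts for [I_pq]. *)
Definition support_cycle (x y : nat) : bool :=
  [&& in_support x, in_support y & (x == q) && (y == p) || (y == x.+1)].

Lemma sum_in_support (F : nat -> k) :
  \sum_(x < n.+1 | in_support x) F x = F q + \sum_(p <= z < q) F z.
Proof.
rewrite addrC -big_nat_recr //= (big_nat_widenl _ 0) //=.
rewrite (big_nat_widen _ _ n.+1) ?ltn_ord //=.
by rewrite big_mkord; apply: eq_bigl => x; rewrite ltnS.
Qed.

Lemma factorization :
  row_factor *m (\matrix_(x, y) (support_cycle x y)%:R) *m col_factor
    = \matrix_(x, y) (if in_support x && in_support y then (indec_entry y x)%:R
                       else 0).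
Proof.
apply/matrixP=> x y; rewrite -mulmxA !mxE.
under eq_bigr do rewrite !mxE.
(* nxt z is the column in which row z of the cycle has its entry. *)
pose nxt (z : nat) := if z == q then nat_of_ord p else z.+1.
have support_cycleE z : \sum_(j < n.+1) (support_cycle z j)%:R * col_factor j y
   = if in_support z then
       if in_support y then col_coef (nxt z) y * left_sign y else 0
     else 0.
  case: (boolP (in_support z)) => zpq; last first.
    by rewrite big1 // => j _; rewrite /support_cycle (negbTE zpq) mul0r.
  have [j jE] : exists j : 'I_n.+1, j = nxt z :> nat.
    rewrite /nxt; case: eqP => [_|zq]; first by exists p.
    have zn : (z.+1 < n.+1)%N by move: zpq (ltn_ord q); rewrite /in_support; lia.
    by exists (Ordinal zn).
  have cj (j' : 'I_n.+1) : support_cycle z j' = (j' == j).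
    apply/idP/eqP => [|->]; last first.
      by rewrite /support_cycle jE /nxt; move: zpq; rewrite /in_support; case: eqP; lia.
    move=> h; apply/val_inj; move: h zpq.
    rewrite /= jE /nxt /support_cycle /in_support; case: eqP; lia.
  rewrite (bigD1 j) //= cj eqxx mul1r big1 ?addr0; last first.
    by move=> j' ne; rewrite cj (negbTE ne) mul0r.
  have jpq : in_support j by have := cj j; rewrite eqxx => /and3P[].
  rewrite mxE jpq /= jE; case: (boolP (in_support y)) => //= ypq.
  by case: eqP => [e|]; [rewrite -e jpq in ypq | rewrite mul0r].
under eq_bigr do under eq_bigr do rewrite mxE.
case: (boolP (in_support x)) => xpq /=; last first.
  rewrite big1 // => z _; rewrite support_cycleE.
  case: eqP => [<-|_]; first by rewrite (negbTE xpq) mulr0.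
  by rewrite mulr0 mul0r.
case: (boolP (in_support y)) => ypq; last first.
  by rewrite big1 // => z _; rewrite support_cycleE (negbTE ypq) if_same mulr0.
rewrite -left_sign_entry -factor_identity //.
have -> : row_coef x q * col_coef p y + \sum_(p <= z < q) row_coef x z * col_coef z.+1 y
   = \sum_(z < n.+1 | in_support z) row_coef x z * col_coef (nxt z) y.
  rewrite (sum_in_support (fun z => row_coef x z * col_coef (nxt z) y)) /nxt eqxx.
  congr (_ + _); apply: eq_big_nat => z /andP[_ zq].
  by rewrite ltn_eqF.
rewrite [in RHS]big_mkcond mulr_sumr mulr_suml; apply: eq_bigr => z _.
by rewrite support_cycleE ypq; case: ifP => _; rewrite ?mulr0 ?mul0r // !mulrA.
Qed.


Lemma natb_neq0 (b : bool) : (b%:R : k) != 0 -> b.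
Proof. by case: b; rewrite ?eqxx. Qed.

Lemma row_factor_triangular (x z : 'I_n.+1) :
  row_factor x z != 0 -> (row_key Q x <= row_key Q z)%N.
Proof.
rewrite mxE mulf_eq0 (negbTE (left_sign_neq0 x)) /=.
case: ifP => [/andP[xpq zpq]|_]; last first.
  by have [->|_] := eqVneq x z; rewrite ?eqxx.
rewrite /row_coef; case: (val z =P q) => [/val_inj ->|_].
  case: (val x =P q) => [/val_inj -> // | _]; rewrite /row_key /=.
  by case: (rt x); rewrite ?eqxx //; move: xpq (ltn_ord q); rewrite /in_support;
    case: (rt q); lia.
case: (val x =P z) => [/val_inj -> //|_]; rewrite subr0 /row_key.
case: (boolP (rt z)) => zr /=; first by rewrite eqxx.
case: (boolP (rp z.+1 x)) => [/right_path_le zx _|]; last by rewrite eqxx.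
by move: (ltn_ord x) (ltn_ord z); case: (rt x); lia.
Qed.

Lemma row_factor_diag x : row_factor x x != 0.
Proof.
rewrite mxE mulf_neq0 ?left_sign_neq0 //.
case: ifP => _; last by rewrite eqxx oner_neq0.
rewrite /row_coef eqxx; case: (val x =P q) => /= [_|_]; first exact: oner_neq0.
by rewrite right_path_gt // andbF sub0r oppr_eq0 oner_neq0.
Qed.

Lemma col_factor_triangular (z y : 'I_n.+1) :
  col_factor z y != 0 -> (col_key Q z <= col_key Q y)%N.
Proof.
rewrite mxE mulf_eq0 (negbTE (left_sign_neq0 y)) orbF.
case: ifP => [/andP[zpq ypq]|_]; last first.
  by have [->|_] := eqVneq z y; rewrite ?eqxx.
move: zpq ypq (ltn_ord y) (ltn_ord z); rewrite /in_support /col_coef /col_key.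
move=> zpq ypq yn zn.
case: ifPn => [yr|_]; last by case: (val z =P y) => /= [->|_]; rewrite ?eqxx.
case: (val y =P p) yr => [yp _|yp /= yr].
  case: (val z =P p) => [zp|zp]; first by rewrite (val_inj (etrans zp (esym yp))).
  move: zp yp => /= zp yp; case: (rt z.-1) => /=; first by move/natb_neq0; lia.
  by case: (rt y.-1); case: (val z =P 0%N); case: (val y =P 0%N) => /=; lia.
rewrite yr orbT; move: yp => /= yp; case: (val z =P p) => /= zp.
  by case: (rt z.-1); case: (val z =P 0%N) => /=; lia.
case: (rt z.-1); case: (val z =P 0%N) => /= z0; rewrite ?oppr_eq0 => /natb_neq0; lia.
Qed.

Lemma col_factor_diag y : col_factor y y != 0.
Proof.
rewrite mxE mulf_neq0 ?left_sign_neq0 //.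
case: ifP => _; last by rewrite eqxx oner_neq0.
rewrite /col_coef eqxx; case: ifPn => [|_]; last exact: oner_neq0.
by case: (val y =P p) => /= [_ _|_ ->]; rewrite ?leqnn oner_neq0.
Qed.

(** Every block row and block column of the Zelevinsky matrix of [I_pq] has
    size one or zero, so this matrix is, up to the order of its rows and columns,
    the matrix over the vertices [p, .., q]. *)
Lemma zelevinsky_rank_indec_mask (I J : pred 'I_n.+1) :
  zelevinsky_rank (@indec k n Q p q) I J
   = \rank (rect_mask I J (\matrix_(x, y)
       (if in_support x && in_support y then (indec_entry y x)%:R else 0 : k))).
Proof.
set P := rect_mask _ _ _; rewrite /zelevinsky_rank; set B := blocked_mx _ _ _.
have inlab s (i : 'I_(bdim (indec_dim p q) s)) : in_support (label i).
  have : (0 < indec_dim p q (label i))%N.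
    exact: leq_ltn_trans (leq0n _) (ltn_ord (tagnat.sig2 i)).
  by rewrite /indec_dim lt0b.
have BE i j : B i j = P (label i) (label j).
  rewrite !mxE !inlab /= -/(label i) -/(label j).
  by case: ifP => _; rewrite ?mxE // zelevinsky_block_indec.
have exlab (s : seq 'I_n.+1) (x : 'I_n.+1) :
    perm_eq s (enum 'I_n.+1) -> in_support x ->
    exists i : 'I_(bdim (indec_dim p q) s), label i = x.
  move=> sperm xpq; have xs : x \in s by rewrite (perm_mem sperm) mem_enum.
  have it : (index x s < size s)%N by rewrite index_mem.
  have xE : tnth (in_tuple s) (Ordinal it) = x by rewrite (tnth_nth x) /= nth_index.
  have d_gt0 : (0 < indec_dim p q (tnth (in_tuple s) (Ordinal it)))%N.
    by rewrite xE /indec_dim -/(in_support x) xpq.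
  by exists (tagnat.Rank (Ordinal it) (Ordinal d_gt0)); rewrite /label tagnat.Rank1K.
apply/eqP; rewrite eqn_leq; apply/andP; split.
  by apply: (@mxrank_partial_reindex _ _ _ _ _ _ _
    (fun i => Some (label i)) (fun j => Some (label j))).
apply: (@mxrank_partial_reindex _ _ _ _ _ _ _
  (fun x => [pick i | label i == x]) (fun y => [pick j | label j == y])) => x y.
case: pickP => [i /eqP ix|nox]; last first.
  rewrite !mxE; case: (boolP (in_support x)) => [xpq|_]; last by rewrite if_same.
  have [i ix] := exlab _ _ (perm_row_labels Q) xpq.
  by have := nox i; rewrite ix eqxx.
case: pickP => [j /eqP jy|noy]; last first.
  rewrite !mxE; case: (boolP (in_support y)) => [ypq|_]; last by rewrite andbF if_same.
  have [j jy] := exlab _ _ (perm_col_labels Q) ypq.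
  by have := noy j; rewrite jy eqxx.
by rewrite BE ix jy.
Qed.

Lemma zelevinsky_rank_indec (I J : pred 'I_n.+1) :
  (forall x x' : 'I_n.+1, I x -> (row_key Q x <= row_key Q x')%N -> I x') ->
  (forall y y' : 'I_n.+1, J y -> (col_key Q y' <= col_key Q y)%N -> J y') ->
  zelevinsky_rank (@indec k n Q p q) I J
    = (\sum_(x | I x) \sum_(y | J y) support_cycle x y)%N.
Proof.
move=> upI downJ; rewrite zelevinsky_rank_indec_mask -factorization.
rewrite (mxrank_rect_mask_triangular _ (@row_key_inj _ Q) (@col_key_inj _ Q)) //; last first.
- exact: col_factor_diag.
- exact: col_factor_triangular.
- exact: row_factor_diag.
- exact: row_factor_triangular.
pose R (x y : 'I_n.+1) := [&& I x, J y & support_cycle x y].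
have -> : rect_mask I J (\matrix_(x, y) (support_cycle x y)%:R)
    = \matrix_(x, y) (R x y)%:R :> 'M[k]_n.+1.
  by apply/matrixP => x y; rewrite !mxE /R; case: (I x); case: (J y).
rewrite mxrank_partial_perm.
- rewrite cardsE -sum1_card big_mkcond /=.
  rewrite -(pair_bigA _ (fun x y : 'I_n.+1 => if R x y then 1 else 0)%N).
  rewrite [RHS]big_mkcond; apply: eq_bigr => x _; rewrite /R.
  case: (I x) => /=; last by rewrite big1.
  by rewrite [RHS]big_mkcond; apply: eq_bigr => y _; case: (J y); case: (support_cycle x y).
- move=> x y y' /and3P[_ _ h] /and3P[_ _ h']; apply/val_inj.
  by move: h h'; rewrite /support_cycle /in_support /=; lia.
- move=> x x' y /and3P[_ _ h] /and3P[_ _ h']; apply/val_inj.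
  by move: h h'; rewrite /support_cycle /in_support /=; lia.
Qed.
End Factor.

(** * Nonzero entries of blocks and southwest ranks *)

(** By induction on the key: the difference of the sums up to [y] and before
    [y] is the value at [y]. *)
Lemma eq_of_prefix_sums (T : finType) (key : T -> nat) (f g : T -> nat) :
  injective key ->
  (forall y, \sum_(y' | key y' <= key y) f y' = \sum_(y' | key y' <= key y) g y')%N ->
  f =1 g.
Proof.
move=> key_inj eqS y; have [m] := ubnP (key y); elim: m y => // m IH y lt_ym.
have split h : (\sum_(y' | key y' <= key y) h y'
    = h y + \sum_(y' | key y' < key y) h y')%N.
  rewrite (bigD1 y) //=; congr (_ + _)%N; apply: eq_bigl => y'.
  by rewrite ltn_neqAle (inj_eq key_inj) andbC.
have := eqS y; rewrite !split (eq_bigr g) => [/addIn //|y' lt_y'y].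
by apply: IH; lia.
Qed.

Section Counting.
Variables (n : nat) (Q : quiverA n).

(** Final segments of the rows become initial segments once the row keys, which
    are at most [n + n], are reversed. *)
Lemma eq_of_southwest_sums (f g : 'I_n.+1 -> 'I_n.+1 -> nat) :
  (forall x y,
     \sum_(x' | preceq (row_labels Q) x x')
       \sum_(y' | preceq (col_labels Q) y' y) f x' y'
     = \sum_(x' | preceq (row_labels Q) x x')
         \sum_(y' | preceq (col_labels Q) y' y) g x' y')%N ->
  forall x y, f x y = g x y.
Proof.
move=> eqS x.
apply: (@eq_of_prefix_sums _ (fun y : 'I_n.+1 => col_key Q y)) => [|y].
  exact: col_key_inj.
have le_key (z : 'I_n.+1) : (row_key Q z <= n + n)%N.
  by have := ltn_ord z; rewrite /row_key; case: ifP => _; lia.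
have eqJ (y' : 'I_n.+1) : (col_key Q y' <= col_key Q y)%N = preceq (col_labels Q) y' y.
  by rewrite preceq_col.
rewrite !(eq_bigl _ _ eqJ); move: x.
apply: (@eq_of_prefix_sums _ (fun x : 'I_n.+1 => n + n - row_key Q x)%N) => [x x' eqk|x].
  by apply: (@row_key_inj _ Q); have := le_key x; have := le_key x'; move: eqk => /=; lia.
have eqI (x' : 'I_n.+1) :
    (n + n - row_key Q x' <= n + n - row_key Q x)%N = preceq (row_labels Q) x x'.
  by rewrite preceq_row; have := le_key x; have := le_key x'; lia.
by rewrite !(eq_bigl _ _ eqI) eqS.
Qed.

Variable k : fieldType.

Lemma southwest_perm_rank d (w : 'S_(totdim d)) x y :
  \rank (southwest (blocked_perm_mx k Q w) x y)
    = (\sum_(x' | preceq (row_labels Q) x x') \sum_(y' | preceq (col_labels Q) y' y)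
        #|block_support (blocked_perm_mx k Q w) x' y'|)%N.
Proof.
rewrite /southwest mxrank_submx.
set I := [set i | _]; set J := [set j | _].
pose R i j := [&& i \in I, j \in J &
  cast_ord (bdim_row Q d) i == w (cast_ord (bdim_col Q d) j)].
have -> : rect_mask (fun i => i \in I) (fun j => j \in J) (blocked_perm_mx k Q w)
   = \matrix_(i, j) (R i j)%:R.
  by apply/matrixP => i j; rewrite !mxE /R; case: (i \in I); case: (j \in J).
rewrite mxrank_partial_perm; last first.
- move=> i i' j /and3P[_ _ /eqP h] /and3P[_ _ /eqP h'].
  by apply: (@cast_ord_inj _ _ (bdim_row Q d)); rewrite h h'.
- move=> i j j' /and3P[_ _ /eqP h] /and3P[_ _ /eqP h'].
  apply: (@cast_ord_inj _ _ (bdim_col Q d)).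
  by apply: (@perm_inj _ w); rewrite -h -h'.
rewrite -sum1_card (partition_big (fun ij => label ij.1) (preceq (row_labels Q) x)) /=; last first.
  by move=> [i j]; rewrite inE => /and3P[]; rewrite inE.
apply: eq_bigr => x' xx'.
rewrite (partition_big (fun ij => label ij.2)
  (fun y' => preceq (col_labels Q) y' y)) /=; last first.
  by move=> [i j]; rewrite inE => /andP[/and3P[_]]; rewrite inE.
apply: eq_bigr => y' yy'; rewrite -sum1_card; apply: eq_bigl => -[i j] /=.
rewrite !inE /R !inE mxE /=; apply/idP/idP.
  by move=> /andP[/andP[/and3P[_ _ ->] /eqP ->] /eqP ->]; rewrite !eqxx oner_neq0.
move=> /and3P[/eqP -> /eqP -> ]; rewrite xx' yy' !eqxx.
by case: (cast_ord _ i == _); rewrite ?eqxx.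
Qed.

Lemma southwest_zelevinsky_rank d (V : rep k Q d) x y :
  \rank (southwest (zelevinsky_mx V) x y)
    = zelevinsky_rank V (preceq (row_labels Q) x)
        (fun y' => preceq (col_labels Q) y' y).
Proof.
rewrite /southwest mxrank_submx /zelevinsky_rank; congr mxrank.
apply/matrixP => i j; rewrite !mxE !inE -/(label i) -/(label j).
by case: ifP => _; rewrite ?mxE.
Qed.

Lemma sum_with_mult (m : 'I_n.+1 -> 'I_n.+1 -> nat)
    (F : 'I_n.+1 * 'I_n.+1 -> nat) :
  (\sum_(pq <- with_mult m) F pq
   = \sum_(p < n.+1) \sum_(q < n.+1) (if p <= q then m p q else 0) * F (p, q))%N.
Proof.
rewrite big_flatten big_allpairs_dep /= big_enum; apply: eq_bigr => p _.
rewrite big_enum; apply: eq_bigr => q _.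
by rewrite big_nseq iter_addn_0 mulnC.
Qed.

Lemma mem_with_mult (m : 'I_n.+1 -> 'I_n.+1 -> nat) pq :
  pq \in with_mult m -> (pq.1 <= pq.2)%N.
Proof.
move=> /flattenP[_ /allpairsP[[p q] [_ _ ->]]] /=.
by rewrite mem_nseq => /andP[+ /eqP ->] /=; case: ifP.
Qed.

Lemma southwest_zelevinsky_rank_indecs d (V : rep k Q d) m :
  rep_iso V (indecs_sum k Q (with_mult m)) -> forall x y,
  \rank (southwest (zelevinsky_mx V) x y)
    = (\sum_(x' | preceq (row_labels Q) x x') \sum_(y' | preceq (col_labels Q) y' y)
        \sum_(pq <- with_mult m) support_cycle pq.1 pq.2 x' y')%N.
Proof.
move=> V_m x y; rewrite southwest_zelevinsky_rank (zelevinsky_rank_iso _ _ V_m).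
rewrite zelevinsky_rank_indecs_sum.
under [RHS]eq_bigr do rewrite exchange_big.
rewrite exchange_big; apply: eq_big_seq => pq /mem_with_mult le_pq.
rewrite zelevinsky_rank_indec //.
- by move=> a b; rewrite !preceq_row; exact: leq_trans.
- by move=> a b; rewrite !preceq_col => h h'; exact: leq_trans h' h.
Qed.

Lemma sum_support_cycle (m : 'I_n.+1 -> 'I_n.+1 -> nat) (x y : 'I_n.+1) :
  (\sum_(pq <- with_mult m) support_cycle pq.1 pq.2 x y =
    if y <= x then m y x
     else if y == x.+1 :> nat then
       \sum_(p < n.+1) \sum_(q < n.+1 | (p <= x < y) && (y <= q)) m p q
     else 0)%N.
Proof.
rewrite sum_with_mult /=; case: leqP => [yx|xy].
  have support_cycleE (p q : 'I_n.+1) :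
      ((if p <= q then m p q else 0) * support_cycle p q x y
      = if (q == x) && (p == y) then m y x else 0)%N.
    have -> : ((q == x) && (p == y)) = (p <= q)%N && support_cycle p q x y.
      by rewrite /support_cycle /in_support -!val_eqE /=; apply/idP/idP; lia.
    case: leqP => //= pq.
    case: (boolP (support_cycle p q x y)) => [h|_]; rewrite ?muln0 // muln1.
    by congr m; apply/val_inj; move: h; rewrite /support_cycle /in_support /=; lia.
  under eq_bigr do under eq_bigr do rewrite support_cycleE.
  rewrite (bigD1 y) //= [X in (_ + X)%N]big1 ?addn0 => [|p /negbTE ->]; last first.
    by rewrite big1 // => q _; rewrite andbF.
  rewrite (bigD1 x) //= !eqxx [X in (_ + X)%N]big1 ?addn0 // => q /negbTE ->.
  by [].
case: eqP => [yx|yx].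
  apply: eq_bigr => p _; rewrite [RHS]big_mkcond; apply: eq_bigr => q _.
  have -> : support_cycle p q x y = (p <= x)%N && (y <= q)%N.
    by rewrite /support_cycle /in_support; apply/idP/idP; lia.
  rewrite andbT; case: (boolP ((p <= x) && (y <= q))%N) => [h|_]; last first.
    by rewrite muln0.
  by rewrite muln1 ifT //; lia.
rewrite big1 // => p _; rewrite big1 // => q _.
case: (boolP (support_cycle p q x y)) => [h|_]; rewrite ?muln0 //.
case: leqP => // pq; move: h; rewrite /support_cycle /in_support; lia.
Qed.

End Counting.

Theorem theorem1p2 (k : closedFieldType) (n : nat) (Q : quiverA n)
  (d : 'I_n.+1 -> nat) (d_gt0 : forall x, (0 < d x)%N)
  (V : rep k Q d) (r : 'I_n.+1 -> 'I_n.+1 -> nat)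
  (V_r : has_rank_parameter V r)
  (m : 'I_n.+1 -> 'I_n.+1 -> nat)
  (V_m : rep_iso V (indecs_sum k Q (with_mult m)))
  (w : 'S_(totdim d)) (w_zel : is_zelevinsky_perm k Q r w)
  (x y : 'I_n.+1) :
  #|block_support (blocked_perm_mx k Q w) x y| =
    (if y <= x then m y x
     else if y == x.+1 :> nat then
       \sum_(p < n.+1) \sum_(q < n.+1 | (p <= x < y) && (y <= q)) m p q
     else 0)%N.
Proof.
rewrite -sum_support_cycle; move: x y.
apply: (eq_of_southwest_sums (Q := Q)) => x y.
rewrite -southwest_perm_rank -(southwest_zelevinsky_rank_indecs V_m).
(* The southwest ranks of w are those of V, which lies in its own orbit. *)
case: w_zel => _; apply; exists V; split=> //; exists (fun=> 1%:M); split=> [z|e].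
  exact: unitmx1.
by rewrite mul1mx invmx1 mulmx1.
Qed.
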